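(* Fix $k \in \mathbb{N}_0$. For all clause-sets $F, F' \in \mathrm{WC}_k$ (note $\mathrm{WC}_k \supseteq \mathrm{UC}_k \supseteq \mathrm{PC}_k$), the queries CO, CE, VA, IM, EQ and SE are decidable in polynomial time (in $\ell(F)$). Furthermore, ME is possible in time $p(\ell(F), m)$ for some fixed polynomial $p$, where $m$ is the number of satisfying total assignments of $F$.
   Context: Clauses are finite sets of literals without complementary pair; clause-sets (interpreted as CNFs) are finite sets of clauses; $\ell(F)=\sum_{C\in F}|C|$. A partial assignment $\varphi$ applied to $F$, $\varphi*F$, removes clauses containing a literal set to $1$ and removes literals set to $0$. W-hardness $\mathrm{whd}(F)$: for unsatisfiable $F$ the minimum $k$ such that a resolution tree deriving the empty clause from $F$ exists in which each resolution step has a parent clause of length at most $k$; $\mathrm{whd}$ of the empty clause-set is $0$; for satisfiable nonempty $F$ the maximum of $\mathrm{whd}(\varphi*F)$ over partial assignments with $\varphi*F$ unsatisfiable. $\mathrm{WC}_k := \{F : \mathrm{whd}(F)\le k\}$. Queries for a clause-set $F$ representing the boolean function on $\mathrm{var}(F)$: CO — whether $F$ is satisfiable; CE — given a clause $C$, whether $F\models C$; VA — whether $F$ is satisfied by all total assignments; IM — given a partial assignment $\varphi$, whether every total extension of $\varphi$ satisfies $F$; SE — given $F,F'$, whether $F\models F'$; EQ — given $F,F'$, whether they are logically equivalent; ME — enumerate all satisfying total assignments of $F$. *)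

(* Defs.v *)
From mathcomp Require Import all_boot all_algebra finmap.

Set Implicit Arguments.
Unset Strict Implicit.
Unset Printing Implicit Defensive.

Import GRing.Theory.
Local Open Scope fset_scope.
Local Open Scope fmap_scope.
Local Open Scope nat_scope.

(** * Clause-sets *)

Definition var := nat.

(** [(v, true)] is the positive literal on [v], [(v, false)] the negative one;
    [(v, b)] is set to 1 exactly by the assignments giving [v] the value [b]. *)
Definition lit : Type := (var * bool)%type.
Definition neg (x : lit) : lit := (x.1, ~~ x.2).

Definition clause := {fset lit}.
Definition clauseset := {fset clause}.

Definition is_clause (C : clause) : Prop :=
  forall x, x \in C -> neg x \notin C.
Definition is_clauseset (F : clauseset) : Prop :=
  forall C, C \in F -> is_clause C.

Definition vars (F : clauseset) : {fset var} :=
  [fset x.1 | C in F, x in (C : {fset lit})].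

Definition ell (F : clauseset) : nat := \sum_(C <- F) #|` C|.

(** * Assignments *)

Definition passign := {fmap var -> bool}.

Definition lit_true (phi : passign) (x : lit) : bool :=
  phi.[? x.1] == Some x.2.
Definition lit_false (phi : passign) (x : lit) : bool :=
  phi.[? x.1] == Some (~~ x.2).

Definition papply (phi : passign) (F : clauseset) : clauseset :=
  [fset [fset x in (C : {fset lit}) | ~~ lit_false phi x]
     | C in F & ~~ has (lit_true phi) (C : {fset lit})].

Definition tassign := var -> bool.

Definition sat_clause (f : tassign) (C : clause) : Prop :=
  exists2 x, x \in C & f x.1 = x.2.
Definition sat (f : tassign) (F : clauseset) : Prop :=
  forall C, C \in F -> sat_clause f C.

Definition extends (f : tassign) (phi : passign) : Prop :=
  forall v b, phi.[? v] = Some b -> f v = b.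
Definition restrict (f : tassign) (V : {fset var}) : passign :=
  [fmap v : V => f (val v)].

Definition satisfiable (F : clauseset) : Prop := exists f, sat f F.

(** * W-hardness *)

Definition resolvable (C D : clause) (x : lit) : Prop :=
  C `&` [fset neg y | y in D] = [fset x].
Definition resolvent (C D : clause) (x : lit) : clause :=
  (C `\ x) `|` (D `\ neg x).

(** [wres F k C]: there is a resolution tree from [F] with root [C] in which
    every resolution step has a parent clause of length at most [k]. *)
Inductive wres (F : clauseset) (k : nat) : clause -> Prop :=
| wres_axiom C : C \in F -> wres F k C
| wres_step C D x :
    wres F k C -> wres F k D -> resolvable C D x ->
    #|` C| <= k \/ #|` D| <= k ->
    wres F k (resolvent C D x).

Definition whd_unsat (F : clauseset) (h : nat) : Prop :=
  wres F h fset0 /\ forall j, wres F j fset0 -> h <= j.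

(** [whd F h]: the W-hardness of [F] equals [h].  Every clause-set has a
    W-hardness: resolution is complete, and only the restrictions of [phi] to
    [vars F] matter in the maximum. *)
Variant whd (F : clauseset) (h : nat) : Prop :=
| whd_of_unsat of ~ satisfiable F & whd_unsat F h
| whd_of_empty of F = fset0 & h = 0
| whd_of_sat of
    satisfiable F & F <> fset0
    & (exists2 phi, ~ satisfiable (papply phi F) & whd_unsat (papply phi F) h)
    & (forall phi j, ~ satisfiable (papply phi F) ->
         whd_unsat (papply phi F) j -> j <= h).

Definition WC (k : nat) (F : clauseset) : Prop :=
  is_clauseset F /\ exists2 h, whd F h & h <= k.

(** * Machine model *)

(** Jones's WHILE language over binary trees (N. D. Jones, "Computability and
    Complexity from a Programming Perspective", MIT Press 1997).  The leaves
    [Atom a] hold variable names.  A program can only copy an atom and test it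
    for equality, so an atom counts as one unit, in accordance with [ell]
    counting literal occurrences. *)
Inductive data := Nil | Atom of nat | Cons of data & data.

Fixpoint dsize (d : data) : nat :=
  if d is Cons a b then (dsize a + dsize b).+1 else 1.
Fixpoint deq (d e : data) : bool :=
  match d, e with
  | Nil, Nil => true
  | Atom a, Atom b => a == b
  | Cons d1 d2, Cons e1 e2 => deq d1 e1 && deq d2 e2
  | _, _ => false
  end.
Definition dhd (d : data) := if d is Cons a _ then a else Nil.
Definition dtl (d : data) := if d is Cons _ b then b else Nil.

Definition dbool (b : bool) : data := if b then Cons Nil Nil else Nil.
Definition dtest (d : data) : bool := if d is Nil then false else true.

Inductive expr :=
| EVar of nat
| ENil
| ECons of expr & expr
| EHd of expr
| ETl of expr
| EEq of expr & expr.

Inductive cmd :=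
| CSkip
| CAssign of nat & expr
| CSeq of cmd & cmd
| CIf of expr & cmd & cmd
| CWhile of expr & cmd.

Definition store := nat -> data.
Definition upd (s : store) (x : nat) (d : data) : store :=
  fun y => if y == x then d else s y.

Fixpoint eval (s : store) (e : expr) : data :=
  match e with
  | EVar x => s x
  | ENil => Nil
  | ECons e1 e2 => Cons (eval s e1) (eval s e2)
  | EHd e1 => dhd (eval s e1)
  | ETl e1 => dtl (eval s e1)
  | EEq e1 e2 => dbool (deq (eval s e1) (eval s e2))
  end.

(** Reading a variable costs the size of its whole value, as if trees were
    written out as strings; [ecost s e] thus bounds the size of every tree
    built while evaluating [e], and time is not unit-cost time: iterating
    [x := Cons x x] n times takes time exponential in n. *)
Fixpoint ecost (s : store) (e : expr) : nat :=
  match e with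
  | EVar x => dsize (s x)
  | ENil => 1
  | ECons e1 e2 | EEq e1 e2 => (ecost s e1 + ecost s e2).+1
  | EHd e1 | ETl e1 => (ecost s e1).+1
  end.

(** [exec c s t s']: started in [s], [c] halts after time [t] in [s']. *)
Inductive exec : cmd -> store -> nat -> store -> Prop :=
| exec_skip s : exec CSkip s 1 s
| exec_assign s x e :
    exec (CAssign x e) s (ecost s e).+1 (upd s x (eval s e))
| exec_seq c1 c2 s1 s2 s3 t1 t2 :
    exec c1 s1 t1 s2 -> exec c2 s2 t2 s3 ->
    exec (CSeq c1 c2) s1 (t1 + t2).+1 s3
| exec_if e c1 c2 s t s' :
    exec (if dtest (eval s e) then c1 else c2) s t s' ->
    exec (CIf e c1 c2) s (ecost s e + t).+1 s'
| exec_while_false e c s :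
    ~~ dtest (eval s e) -> exec (CWhile e c) s (ecost s e).+1 s
| exec_while_true e c s1 s2 s3 t1 t2 :
    dtest (eval s1 e) -> exec c s1 t1 s2 -> exec (CWhile e c) s2 t2 s3 ->
    exec (CWhile e c) s1 (ecost s1 e + t1 + t2).+1 s3.

(** Input and output are passed in variable 0; the other variables start with
    [Nil]. *)
Definition computes (P : cmd) (input output : data) (t : nat) : Prop :=
  exists2 s, exec P (upd (fun=> Nil) 0 input) t s & s 0 = output.

(** * Encodings *)

Inductive list_code (A : Type) (code : A -> data -> Prop) :
  seq A -> data -> Prop :=
| list_code_nil : list_code code [::] Nil
| list_code_cons x s d e :
    code x d -> list_code code s e -> list_code code (x :: s) (Cons d e).

(** A finite set is encoded by any repetition-free listing of its elements, in
    arbitrary order; so an object has many codes, and programs must work for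
    all of them. *)
Definition fset_code (A : choiceType) (code : A -> data -> Prop)
    (X : {fset A}) (d : data) : Prop :=
  exists s : seq A, [/\ uniq s, s =i X & list_code code s d].

Definition pair_code (A B : Type) (codeA : A -> data -> Prop)
    (codeB : B -> data -> Prop) (xy : A * B) (d : data) : Prop :=
  exists a b, [/\ codeA xy.1 a, codeB xy.2 b & d = Cons a b].

Definition lit_code (x : lit) (d : data) : Prop :=
  d = Cons (Atom x.1) (dbool x.2).
Definition clause_code : clause -> data -> Prop := fset_code lit_code.
Definition clauseset_code : clauseset -> data -> Prop := fset_code clause_code.

(** A partial assignment is encoded as the set of literals it sets to 1. *)
Definition passign_code (phi : passign) (d : data) : Prop :=
  exists2 X : clause, (forall x, x \in X = lit_true phi x) & clause_code X d.

(** * Polynomial time *)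

(** Polynomial-time decidability of [Q] on the inputs satisfying [dom], with
    [size] measuring the input. *)
Definition polytime_decidable (I : Type) (code : I -> data -> Prop)
    (size : I -> nat) (dom Q : I -> Prop) : Prop :=
  exists (P : cmd) (p : {poly nat}),
    forall i d, dom i -> code i d ->
      exists b t, [/\ computes P d (dbool b) t, t <= p.[size i]%R & b <-> Q i].

(** * Queries *)

Definition CO (F : clauseset) : Prop := satisfiable F.
Definition CE (FC : clauseset * clause) : Prop :=
  forall f, sat f FC.1 -> sat_clause f FC.2.
Definition VA (F : clauseset) : Prop := forall f, sat f F.
Definition IM (Fphi : clauseset * passign) : Prop :=
  forall f, extends f Fphi.2 -> sat f Fphi.1.
Definition SE (FF : clauseset * clauseset) : Prop :=
  forall f, sat f FF.1 -> sat f FF.2.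
Definition EQ (FF : clauseset * clauseset) : Prop :=
  forall f, sat f FF.1 <-> sat f FF.2.

(** [M] is the set of satisfying total assignments on [vars F]. *)
Definition is_models (F : clauseset) (M : {fset passign}) : Prop :=
  forall phi, phi \in M <-> exists2 f, sat f F & phi = restrict f (vars F).

(* Main.v *)
Require Import Defs.
From Stdlib Require Import Classical.
From HB Require Import structures.
From mathcomp Require Import all_boot all_algebra finmap zify.

Set Implicit Arguments.
Unset Strict Implicit.
Unset Printing Implicit Defensive.

Local Open Scope fset_scope.
Local Open Scope fmap_scope.
Local Open Scope nat_scope.

(** W-hardness at most [k] is captured by a closure that only stores clauses of
    length at most [k + 1], although the derivations it stands for use clauses of
    arbitrary length.  A set [S] of implicates [E \/ x] with [|E| <= k], read as
    "falsifying [E] propagates [x]", is closed under unit propagation by the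
    clauses of [F] and of [S].  By induction on a resolution tree, if the
    falsification of [E] propagates to all literals of a derived clause, then [S]
    records a conflict for [E]: a parent of length at most [k] belongs to [S], so
    it propagates the resolved literal, after which the other parent is falsified.
    With [k] fixed there are polynomially many candidates, so [S] is computed in
    polynomial time; if it contains the empty clause, [F] is unsatisfiable, by
    soundness.

    [WC k] is stable under partial assignments in the satisfiable case, so CE, SE
    and EQ reduce to refuting restrictions of [F], and ME extends partial
    assignments variable by variable, discarding those whose restriction is
    refuted: every survivor extends to a model, so there are never more than [m]
    of them.

    Running times are obtained from closure properties of the functions computed
    by polynomial-time WHILE programs. *)

(** * Programs as functions on encoded types *)

HB.mixin Record isEncodable T := { enc : T -> data; enc_inj : injective enc }.
#[short(type="encType")]
HB.structure Definition Encodable := {T of Equality T & isEncodable T}.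

Definition enc_pair (A B : encType) (p : A * B) := Defs.Cons (enc p.1) (enc p.2).
Definition enc_seq (A : encType) (s : seq A) :=
  foldr (fun x d => Defs.Cons (enc x) d) Defs.Nil s.

Lemma Atom_inj : injective Atom.
Proof. by move=> a b []. Qed.

Lemma dbool_inj : injective dbool.
Proof. by case; case. Qed.

Lemma enc_pair_inj (A B : encType) : injective (@enc_pair A B).
Proof. by move=> [a b] [c d] [/enc_inj -> /enc_inj ->]. Qed.

Lemma enc_seq_inj (A : encType) : injective (@enc_seq A).
Proof.
elim=> [|x s IHs] [|y t] //= [/enc_inj -> ts].
by rewrite (IHs t).
Qed.

HB.instance Definition _ := isEncodable.Build nat Atom_inj.
HB.instance Definition _ := isEncodable.Build bool dbool_inj.
HB.instance Definition _ (A B : encType) :=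
  isEncodable.Build (A * B)%type (@enc_pair_inj A B).
HB.instance Definition _ (A : encType) :=
  isEncodable.Build (seq A) (@enc_seq_inj A).

Definition sz (A : encType) (x : A) := dsize (enc x).

Lemma dsize_gt0 d : 0 < dsize d.
Proof. by case: d. Qed.

Lemma sz_gt0 (A : encType) (x : A) : 0 < sz x.
Proof. exact: dsize_gt0. Qed.

Lemma sz_pair (A B : encType) (p : A * B) : sz p = (sz p.1 + sz p.2).+1.
Proof. by []. Qed.

Lemma sz_cons (A : encType) (x : A) (s : seq A) : sz (x :: s) = (sz x + sz s).+1.
Proof. by []. Qed.

Lemma sz_bool (b : bool) : sz b <= 3.
Proof. by case: b. Qed.

Lemma size_sz (A : encType) (s : seq A) : size s < sz s.
Proof. elim: s => // x s IHs; rewrite sz_cons /=; lia. Qed.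

Lemma sz_cat (A : encType) (s t : seq A) : sz (s ++ t) <= sz s + sz t.
Proof. elim: s => [|x s IHs]; rewrite ?cat0s ?cat_cons ?sz_cons; lia. Qed.

Lemma sz_nil (A : encType) : sz ([::] : seq A) = 1.
Proof. by []. Qed.

Lemma sz_filter (A : encType) (p : pred A) (s : seq A) : sz (filter p s) <= sz s.
Proof. elim: s => //= x s IHs; case: ifP; rewrite ?sz_cons; lia. Qed.

Lemma sz_mem (A : encType) (x : A) (s : seq A) : x \in s -> sz x < sz s.
Proof.
elim: s => // y s IHs; rewrite inE sz_cons => /orP[/eqP ->|/IHs]; lia.
Qed.

Lemma sz_seq_le (A : encType) (s : seq A) m :
  (forall x, x \in s -> sz x <= m) -> sz s <= (size s * m.+1).+1.
Proof.
elim: s => // x s IHs sm; rewrite sz_cons /= mulSn.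
have := sm x (mem_head _ _).
have := IHs (fun y ys => sm y (mem_behead (s := x :: s) ys)); lia.
Qed.

Lemma deqE d e : reflect (d = e) (deq d e).
Proof.
apply: (iffP idP) => [|->].
  elim: d e => [|a|a IHa b IHb] [|a'|a' b'] //=; first by move=> /eqP ->.
  by case/andP=> /IHa -> /IHb ->.
by elim: e => //= a -> b ->.
Qed.

Lemma deq_enc (A : encType) (x y : A) : deq (enc x) (enc y) = (x == y).
Proof. by apply/deqE/eqP => [/enc_inj|->]. Qed.

Lemma dsize_eval s e : dsize (eval s e) <= ecost s e.
Proof.
elim: e => //= [e IHe f IHf|e IHe|e IHe|e IHe f IHf].
- lia.
- case: (eval s e) IHe => //= *; lia.
- case: (eval s e) IHe => //= *; lia.
- have := leq_trans (dsize_gt0 _) IHe; have := leq_trans (dsize_gt0 _) IHf.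
  case: (deq _ _) => /=; lia.
Qed.

Lemma exec_dsize c s t s' : exec c s t s' ->
  forall n, dsize (s' n) <= dsize (s n) + t.
Proof.
elim=> {c s t s'} //=.
- move=> s n; lia.
- move=> s x e n; rewrite /upd; case: eqP => _; last lia.
  have := dsize_eval s e; lia.
- by move=> c1 c2 s1 s2 s3 t1 t2 _ IH1 _ IH2 n; have := IH1 n; have := IH2 n; lia.
- by move=> e c1 c2 s t s' _ IH n; have := IH n; lia.
- by move=> e c s _ n; lia.
- move=> e c s1 s2 s3 t1 t2 _ _ IH1 _ IH2 n.
  by have := IH1 n; have := IH2 n; lia.
Qed.

Definition pbd (A : Type) (mu T : A -> nat) :=
  exists c, forall a, T a <= (mu a).+2 ^ c.

Lemma pbd_le (A : Type) (mu T T' : A -> nat) :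
  pbd mu T' -> (forall a, T a <= T' a) -> pbd mu T.
Proof. by case=> c cP TT'; exists c => a; apply: leq_trans (cP a). Qed.

Lemma pbd_const (A : Type) (mu : A -> nat) n : pbd mu (fun=> n).
Proof.
case: n => [|n]; first by exists 0.
exists n.+1 => a; apply: ltnW; apply: leq_trans (ltn_expl n.+1 (ltnSn 1)) _.
by rewrite leq_exp2r.
Qed.

Lemma pbd_add (A : Type) (mu T U : A -> nat) :
  pbd mu T -> pbd mu U -> pbd mu (fun a => T a + U a).
Proof.
case=> c cP [d dP]; exists (c + d).+1 => a.
have X0 : 0 < (mu a).+2 by [].
have := cP a; have := dP a.
have := leq_pexp2l X0 (leq_addr d c); have := leq_pexp2l X0 (leq_addl c d).
rewrite expnS; move: (_ ^ (c + d)) => z; nia.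
Qed.

Lemma pbd_mul (A : Type) (mu T U : A -> nat) :
  pbd mu T -> pbd mu U -> pbd mu (fun a => T a * U a).
Proof.
by case=> c cP [d dP]; exists (c + d) => a; rewrite expnD leq_mul.
Qed.

Lemma pbd_S (A : Type) (mu T : A -> nat) :
  pbd mu T -> pbd mu (fun a => (T a).+1).
Proof.
by move=> b; apply: pbd_le (pbd_add b (pbd_const mu 1)) _ => a; rewrite addn1.
Qed.

Lemma pbd_exp (A : Type) (mu T : A -> nat) n :
  pbd mu T -> pbd mu (fun a => T a ^ n).
Proof.
move=> b; elim: n => [|n IHn]; first exact: pbd_const.
by apply: pbd_le (pbd_mul b IHn) _ => a; rewrite expnS.
Qed.

Lemma pbd_id (A : Type) (mu : A -> nat) : pbd mu mu.
Proof. by exists 1 => a; rewrite expn1 -addn2 leq_addr. Qed.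

Lemma pbd_comp (A B : Type) (mu : A -> nat) (nu U : B -> nat) (f : A -> B) :
  pbd nu U -> pbd mu (fun a => nu (f a)) -> pbd mu (fun a => U (f a)).
Proof.
case=> c cP b; apply: pbd_le (pbd_exp c (pbd_S (pbd_S b))) _ => a.
exact: cP.
Qed.

(** Running [P n] transforms register [n] by [f] and may destroy the registers
    above [n]. *)
Definition prog (A B : encType) (P : nat -> cmd) (f : A -> B) (T : A -> nat) :=
  forall n s a, s n = enc a -> exists t s',
    [/\ exec (P n) s t s', s' n = enc (f a), (forall m, m < n -> s' m = s m)
      & t <= T a].

Definition ptime_in (A B : encType) (mu : A -> nat) (f : A -> B) :=
  exists P T, prog P f T /\ pbd mu T.

Definition ptime (A B : encType) (f : A -> B) := ptime_in (@sz A) f.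

Lemma prog_sz (A B : encType) P (f : A -> B) T :
  prog P f T -> forall a, sz (f a) <= sz a + T a.
Proof.
move=> PT a; have [t [s' [e s'0 _ le]]] := PT 0 (fun=> enc a) a erefl.
by rewrite /sz -s'0; apply: leq_trans (exec_dsize e 0) _; rewrite leq_add2l.
Qed.

Lemma ptime_sz (A B : encType) (f : A -> B) :
  ptime f -> pbd (@sz A) (fun a => sz (f a)).
Proof.
case=> P [T [PT b]]; apply: pbd_le (pbd_add (pbd_id _) b) _.
exact: prog_sz PT.
Qed.

Lemma ptime_ext (A B : encType) (f g : A -> B) : ptime f -> f =1 g -> ptime g.
Proof.
case=> P [T [PT b]] fg; exists P, T; split=> // n s a sn.
by rewrite -fg; apply: PT.
Qed.

Lemma updE (s : store) n d : upd s n d n = d.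
Proof. by rewrite /upd eqxx. Qed.

Lemma upd_ne (s : store) n d m : m != n -> upd s n d m = s m.
Proof. by rewrite /upd => /negbTE ->. Qed.

Lemma ptime_id (A : encType) : ptime (fun a : A => a).
Proof.
exists (fun=> CSkip), (fun=> 1); split; last exact: pbd_const.
by move=> n s a sn; exists 1, s; split=> //; apply: exec_skip.
Qed.

Lemma ptime_comp (A B C : encType) (g : B -> C) (f : A -> B) :
  ptime g -> ptime f -> ptime (fun a => g (f a)).
Proof.
move=> [Q [U [QU bU]]] [P [T [PT bT]]].
exists (fun n => CSeq (P n) (Q n)), (fun a => (T a + U (f a)).+1); split.
  move=> n s a sn; have [t [s1 [e1 s1n fr1 le1]]] := PT n s a sn.
  have [u [s2 [e2 s2n fr2 le2]]] := QU n s1 _ s1n.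
  exists (t + u).+1, s2; split=> //; first exact: exec_seq e1 e2.
    by move=> m mn; rewrite fr2 ?fr1.
  by rewrite ltnS leq_add.
apply/pbd_S/pbd_add => //; apply: pbd_comp bU _.
by apply: ptime_sz; exists P, T.
Qed.

Lemma ptime_pure (A B : encType) (e : nat -> expr) (f : A -> B) T :
    (forall n s a, s n = enc a ->
       eval s (e n) = enc (f a) /\ ecost s (e n) <= T a) ->
    pbd (@sz A) T -> ptime f.
Proof.
move=> eP bT; exists (fun n => CAssign n (e n)), (fun a => (T a).+1); split.
  move=> n s a sn; have [ev ec] := eP n s a sn.
  exists (ecost s (e n)).+1, (upd s n (eval s (e n))); split=> //.
  - exact: exec_assign.
  - by rewrite updE.
  - by move=> m mn; rewrite upd_ne // neq_ltn mn.
exact: pbd_S.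
Qed.

Lemma ptime_fst (A B C : encType) (f : A -> B * C) :
  ptime f -> ptime (fun a => (f a).1).
Proof.
move=> pf; apply: (ptime_comp _ pf).
apply: (@ptime_pure _ _ (fun n => EHd (EVar n)) _ (fun a => (sz a).+1)).
  by move=> n s [a b] /= ->.
exact/pbd_S/pbd_id.
Qed.

Lemma ptime_snd (A B C : encType) (f : A -> B * C) :
  ptime f -> ptime (fun a => (f a).2).
Proof.
move=> pf; apply: (ptime_comp _ pf).
apply: (@ptime_pure _ _ (fun n => ETl (EVar n)) _ (fun a => (sz a).+1)).
  by move=> n s [a b] /= ->.
exact/pbd_S/pbd_id.
Qed.

Lemma ptime_nil (A B : encType) : ptime (fun _ : A => [::] : seq B).
Proof.
by apply: (@ptime_pure _ _ (fun=> ENil) _ (fun=> 1)) => //; apply: pbd_const.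
Qed.

Lemma ptime_bool (A : encType) (b : bool) : ptime (fun _ : A => b).
Proof.
apply: (@ptime_pure _ _ (fun=> if b then ECons ENil ENil else ENil) _
          (fun=> 3)) (pbd_const _ _).
by case: b.
Qed.

Lemma ptime_pair (A B C : encType) (f : A -> B) (g : A -> C) :
  ptime f -> ptime g -> ptime (fun a => (f a, g a)).
Proof.
move=> [P [T [PT bT]]] [Q [U [QU bU]]].
exists (fun n => CSeq (CAssign n.+1 (EVar n)) (CSeq (P n.+1)
         (CSeq (CAssign n.+2 (EVar n)) (CSeq (Q n.+2)
           (CAssign n (ECons (EVar n.+1) (EVar n.+2))))))),
  (fun a => T a + U a + sz a + sz a + sz (f a) + sz (g a) + 10); split.
  move=> n s a sn; set s1 := upd s n.+1 (enc a).
  have [t [s2 [e2 s2n fr2 le2]]] := PT n.+1 s1 a (updE _ _ _).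
  set s3 := upd s2 n.+2 (enc a).
  have [u [s4 [e4 s4n fr4 le4]]] := QU n.+2 s3 a (updE _ _ _).
  have s2n' : s2 n = enc a by rewrite fr2 // /s1 upd_ne // neq_ltn ltnSn.
  have s4n' : s4 n.+1 = enc (f a).
    by rewrite fr4 // /s3 upd_ne // neq_ltn ltnSn.
  exists ((dsize (s n)).+1 + (t + ((dsize (s2 n)).+1 +
    (u + (dsize (s4 n.+1) + dsize (s4 n.+2)).+2).+1).+1).+1).+1.
  exists (upd s4 n (Defs.Cons (s4 n.+1) (s4 n.+2))); split.
  - apply: exec_seq (exec_seq e2 (exec_seq _ (exec_seq e4 _))).
    + by rewrite /s1 -sn; apply: exec_assign.
    + by rewrite /s3 -s2n'; apply: exec_assign.
    + exact: exec_assign.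
  - by rewrite updE s4n' s4n.
  - move=> m mn; rewrite upd_ne ?fr4 ?neq_ltn ?mn //; last by lia.
    rewrite /s3 upd_ne ?fr2 ?neq_ltn; try lia.
    by rewrite /s1 upd_ne // neq_ltn; lia.
  - rewrite sn s2n' s4n' s4n /sz; lia.
by do ?[apply: pbd_add => //]; try exact: pbd_id; try exact: pbd_const;
  apply: ptime_sz; [exists P, T|exists Q, U].
Qed.

Lemma ptime_eq (A B : encType) (f g : A -> B) :
  ptime f -> ptime g -> ptime (fun a => f a == g a).
Proof.
move=> pf pg; apply: (ptime_comp (g := fun p => p.1 == p.2) _ (ptime_pair pf pg)).
apply: (@ptime_pure _ _ (fun n => EEq (EHd (EVar n)) (ETl (EVar n))) _
          (fun a => (sz a + sz a).+3)) => [n s [a b] /= ->|].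
  by rewrite /= deq_enc /sz /=; split=> //; lia.
by do 3!apply: pbd_S; apply: pbd_add; apply: pbd_id.
Qed.

Lemma ptime_cons (A B : encType) (f : A -> B) (g : A -> seq B) :
  ptime f -> ptime g -> ptime (fun a => f a :: g a).
Proof.
move=> pf pg; apply: (ptime_comp (g := fun p => p.1 :: p.2) _ (ptime_pair pf pg)).
apply: (@ptime_pure _ _ EVar _ (@sz _)) (pbd_id _) => n s [a b] /= -> //.
Qed.

Lemma ptime_behead (A B : encType) (f : A -> seq B) :
  ptime f -> ptime (fun a => behead (f a)).
Proof.
move=> pf; apply: (ptime_comp _ pf).
apply: (@ptime_pure _ _ (fun n => ETl (EVar n)) _ (fun a => (sz a).+1)).
  by move=> n s [|x a] /= ->.
exact/pbd_S/pbd_id.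
Qed.

Lemma ptime_if (A B : encType) (b : A -> bool) (f g : A -> B) :
  ptime b -> ptime f -> ptime g -> ptime (fun a => if b a then f a else g a).
Proof.
move=> [R [V [RV bV]]] [P [T [PT bT]]] [Q [U [QU bU]]].
exists (fun n => CSeq (CAssign n.+1 (EVar n)) (CSeq (R n.+1)
         (CIf (EVar n.+1) (P n) (Q n)))),
  (fun a => V a + T a + U a + sz a + 10); split.
  move=> n s a sn; set s1 := upd s n.+1 (enc a).
  have [t [s2 [e2 s2n fr2 le2]]] := RV n.+1 s1 a (updE _ _ _).
  have s2n' : s2 n = enc a by rewrite fr2 // /s1 upd_ne // neq_ltn ltnSn.
  have fr m : m < n -> s2 m = s m.
    by move=> mn; rewrite fr2 ?/s1 ?upd_ne // ?neq_ltn; lia.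
  have e1 : exec (CAssign n.+1 (EVar n)) s (sz a).+1 s1.
    by rewrite /s1 /sz -sn; apply: exec_assign.
  have [u [s3 [e3 s3n fr3 le3]]] : exists u s3,
      [/\ exec (if b a then P n else Q n) s2 u s3,
          s3 n = enc (if b a then f a else g a),
          (forall m, m < n -> s3 m = s2 m) & u <= T a + U a].
    case: (b a); [have := PT n s2 a s2n' | have := QU n s2 a s2n'];
      by case=> u [s3 [e3 s3n fr3 le3]]; exists u, s3; split=> //; lia.
  exists ((sz a).+1 + (t + (dsize (s2 n.+1) + u).+1).+1).+1, s3; split=> //.
  - apply: exec_seq e1 (exec_seq e2 _); apply: exec_if.
    by rewrite /= s2n; move: e3; case: (b a).
  - by move=> m mn; rewrite fr3 ?fr.
  - by rewrite s2n; have := sz_bool (b a); rewrite /sz; lia.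
by do ?[apply: pbd_add => //]; [apply: pbd_id|apply: pbd_const].
Qed.

Lemma leq_expl m n c : m <= n -> m ^ c <= n ^ c.
Proof. by case: c => // c mn; rewrite leq_exp2r. Qed.

Definition fold_body (Pg : nat -> cmd) n :=
  CSeq (CAssign n.+3
          (ECons (EVar n) (ECons (EHd (EVar n.+1)) (EVar n.+2))))
    (CSeq (Pg n.+3) (CSeq (CAssign n.+2 (EVar n.+3))
       (CAssign n.+1 (ETl (EVar n.+1))))).

Lemma exec_fold (A B C : encType) Pg (g : A -> B -> C -> C) T c M a :
    prog Pg (fun p : A * (B * C) => g p.1 p.2.1 p.2.2) T ->
    (forall p, T p <= (sz p).+2 ^ c) -> sz a <= M ->
  forall l z n s, sz l <= M ->
    (forall i, sz (foldl (fun y x => g a x y) z (take i l)) <= M) ->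
    s n = enc a -> s n.+1 = enc l -> s n.+2 = enc z ->
  exists t s', [/\ exec (CWhile (EVar n.+1) (fold_body Pg n)) s t s',
    s' n.+2 = enc (foldl (fun y x => g a x y) z l),
    (forall m, m <= n -> s' m = s m)
    & t <= (size l).+1 * ((3 * M).+4 ^ c + 12 * M + 20)].
Proof.
move=> gT Tc aM; elim=> [|x l IHl] z n s lM accM sn sn1 sn2.
  exists (ecost s (EVar n.+1)).+1, s; split=> //.
    by apply: exec_while_false; rewrite /= sn1.
  by rewrite /= sn1 /=; lia.
set s1 := upd s n.+3 (enc (a, (x, z))).
have [t [s2 [e2 s2n fr2 le2]]] := gT n.+3 s1 _ (updE _ _ _).
set s3 := upd s2 n.+2 (s2 n.+3).
set s4 := upd s3 n.+1 (enc l).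
have fr m : m <= n -> s4 m = s m.
  move=> mn; rewrite /s4 upd_ne; last by lia.
  rewrite /s3 upd_ne; last by lia.
  rewrite fr2; last by lia.
  by rewrite /s1 upd_ne //; lia.
have s2n1 : s2 n.+1 = enc (x :: l).
  by rewrite fr2; last lia; rewrite /s1 upd_ne //; lia.
have s3n1 : s3 n.+1 = enc (x :: l) by rewrite /s3 upd_ne //; lia.
have lM' : sz l <= M by move: lM; rewrite sz_cons; lia.
have [||||u [s5 [e5 s5n fr5 le5]]] := IHl (g a x z) n s4 lM'.
- by move=> i; apply: (accM i.+1).
- by rewrite fr.
- exact: updE.
- by rewrite /s4 upd_ne; last lia; rewrite /s3 updE s2n.
have e : exec (fold_body Pg n) s
    ((dsize (s n) + ((dsize (s n.+1)).+1 + dsize (s n.+2)).+1).+2 +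
     (t + ((dsize (s2 n.+3)).+1 + (dsize (s3 n.+1)).+2).+1).+1).+1 s4.
  apply: exec_seq (exec_seq e2 (exec_seq _ _)).
  - have -> : s1 = upd s n.+3 (eval s (ECons (EVar n)
        (ECons (EHd (EVar n.+1)) (EVar n.+2)))) by rewrite /= sn sn1 sn2.
    exact: exec_assign.
  - exact: exec_assign.
  - have -> : s4 = upd s3 n.+1 (eval s3 (ETl (EVar n.+1))) by rewrite /= s3n1.
    exact: exec_assign.
eexists _, s5; split.
- by apply: exec_while_true e e5; rewrite /= sn1.
- exact: s5n.
- by move=> m mn; rewrite fr5 ?fr.
have zM : sz z <= M := accM 0.
have gM : sz (g a x z) <= M by have := accM 1; rewrite /= take0.
have tM : t <= (3 * M).+4 ^ c.
  apply: leq_trans le2 (leq_trans (Tc _) (leq_expl _ _)).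
  move: lM zM aM; rewrite !sz_pair /= sz_cons; lia.
rewrite [in X in _ <= X]/= [X in _ <= X]mulSn.
move: le5 lM zM aM gM tM.
rewrite s3n1 s2n /= sn sn1 sn2 /sz; move: (_ * (_ + 20))%N => Y.
move: (_ ^ c) => X; rewrite /=; lia.
Qed.

(** The intermediate values are bounded by [mu] rather than by the size of the
    input, so that the bound may depend on the output. *)
Lemma ptime_in_foldl (A B C : encType) (mu : A -> nat) (l : A -> seq B)
    (z : A -> C) (g : A -> B -> C -> C) :
    ptime l -> ptime z -> ptime (fun p : A * (B * C) => g p.1 p.2.1 p.2.2) ->
    (forall a, sz a <= mu a) ->
    (forall a i, sz (foldl (fun y x => g a x y) (z a) (take i (l a))) <= mu a) ->
  ptime_in mu (fun a => foldl (fun y x => g a x y) (z a) (l a)).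
Proof.
move=> pl pz [Pg [Tg [gT [c Tc]]]] amu accmu.
have bl := ptime_sz pl; have bz := ptime_sz pz.
have {pl} [Pl [Tl [lT bTl]]] := pl; have {pz} [Pz [Tz [zT bTz]]] := pz.
pose M a := mu a + sz (l a).
have lift (T : A -> nat) : pbd (@sz A) T -> pbd mu T.
  move=> [d dP]; exists d => a; apply: leq_trans (dP a) (leq_expl _ _).
  by rewrite !ltnS.
exists (fun n => CSeq (CAssign n.+1 (EVar n)) (CSeq (Pl n.+1)
  (CSeq (CAssign n.+2 (EVar n)) (CSeq (Pz n.+2)
  (CSeq (CWhile (EVar n.+1) (fold_body Pg n)) (CAssign n (EVar n.+2))))))).
exists (fun a => Tl a + Tz a + M a + M a + M a + 20 +
   (M a).+1 * ((3 * M a).+4 ^ c + 12 * M a + 20)); split.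
  move=> n s a sn; set s1 := upd s n.+1 (enc a).
  have [t [s2 [e2 s2n fr2 le2]]] := lT n.+1 s1 a (updE _ _ _).
  have s2n' : s2 n = enc a by rewrite fr2 // /s1 upd_ne //; lia.
  set s3 := upd s2 n.+2 (enc a).
  have [u [s4 [e4 s4n fr4 le4]]] := zT n.+2 s3 a (updE _ _ _).
  have s4n1 : s4 n.+1 = enc (l a).
    by rewrite fr4 // /s3 upd_ne //; lia.
  have s4n' : s4 n = enc a.
    by rewrite fr4 /s3 ?upd_ne //; lia.
  have aM : sz a <= M a by rewrite /M; have := amu a; lia.
  have lM : sz (l a) <= M a by rewrite /M; lia.
  have accM i : sz (foldl (fun y x => g a x y) (z a) (take i (l a))) <= M a.
    by apply: leq_trans (accmu a i) _; rewrite /M; lia.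
  have [v [s5 [e5 s5n fr5 le5]]] := exec_fold gT Tc aM lM accM s4n' s4n1 s4n.
  eexists _, (upd s5 n (s5 n.+2)); split.
  - apply: exec_seq (exec_seq e2 (exec_seq _ (exec_seq e4 (exec_seq e5 _)))).
    + by rewrite /s1 -sn; apply: exec_assign.
    + by rewrite /s3 -s2n'; apply: exec_assign.
    + exact: exec_assign.
  - by rewrite updE s5n.
  - move=> m mn; rewrite upd_ne ?fr5 ?fr4; try lia.
    rewrite /s3 upd_ne ?fr2; try lia.
    by rewrite /s1 upd_ne //; lia.
  - rewrite /= sn s2n' s5n.
    have := accM (size (l a)); rewrite take_size; have sl := size_sz (l a).
    have : v <= (M a).+1 * ((3 * M a).+4 ^ c + 12 * M a + 20).
      by apply: leq_trans le5 _; rewrite leq_mul2r; apply/orP; right; lia.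
    move: le2 le4 aM lM; rewrite /sz; move: (_ * _)%N => X; lia.
have bM : pbd mu M by apply: pbd_add (pbd_id _) (lift _ bl).
have lb := lift _ bTl; have lz := lift _ bTz.
by do ?[exact: bM | exact: lb | exact: lz | exact: pbd_const | apply: pbd_add
  | apply: pbd_mul | apply: pbd_S | apply: pbd_exp].
Qed.

Lemma ptime_foldl (A B C : encType) (mu : A -> nat) (l : A -> seq B)
    (z : A -> C) (g : A -> B -> C -> C) :
    pbd (@sz A) mu ->
    (forall a i, sz (foldl (fun y x => g a x y) (z a) (take i (l a))) <= mu a) ->
    ptime l -> ptime z -> ptime (fun p : A * (B * C) => g p.1 p.2.1 p.2.2) ->
  ptime (fun a => foldl (fun y x => g a x y) (z a) (l a)).
Proof.
move=> bmu accmu pl pz pg.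
have [||P [T [PT bT]]] := @ptime_in_foldl _ _ _ (fun a => sz a + mu a) _ _ _ pl pz pg.
- by move=> a; rewrite leq_addr.
- by move=> a i; rewrite (leq_trans (accmu a i)) // leq_addl.
exists P, T; split=> //.
by apply: (pbd_comp (f := id)) bT _; apply: pbd_add => //; apply: pbd_id.
Qed.

Lemma sz_take (A : encType) i (s : seq A) : sz (take i s) <= sz s.
Proof.
elim: s i => [|x s IHs] [|i] //=.
by rewrite !sz_cons; have := IHs i; lia.
Qed.

Lemma ptime_rev (A B : encType) (f : A -> seq B) :
  ptime f -> ptime (fun a => rev (f a)).
Proof.
move=> pf; apply: (ptime_comp _ pf).
have revE (s t : seq B) : catrev s t = foldl (fun y x => x :: y) t s.
  by elim: s t => /=.
apply: ptime_ext (_ : ptime (fun s : seq B => foldl (fun y x => x :: y) [::] s))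
    _; last by move=> s; rewrite -revE.
apply: (ptime_foldl (mu := fun s => (sz s).+1) (g := fun _ x y => x :: y)).
- exact/pbd_S/pbd_id.
- move=> s i; apply: leq_trans (_ : sz (take i s) + sz ([::] : seq B) <= _).
    elim: (take i s) [::] => [|x t IHt] y /=; first by lia.
    by apply: leq_trans (IHt _) _; rewrite !sz_cons; lia.
  by rewrite sz_nil addn1 ltnS sz_take.
- exact: ptime_id.
- exact: ptime_nil.
- apply: ptime_cons; first exact/ptime_fst/ptime_snd/ptime_id.
  exact/ptime_snd/ptime_snd/ptime_id.
Qed.

Lemma ptime_foldr (A B C : encType) (mu : A -> nat) (l : A -> seq B)
    (z : A -> C) (g : A -> B -> C -> C) :
    pbd (@sz A) mu ->
    (forall a s t, l a = s ++ t -> sz (foldr (g a) (z a) t) <= mu a) ->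
    ptime l -> ptime z -> ptime (fun p : A * (B * C) => g p.1 p.2.1 p.2.2) ->
  ptime (fun a => foldr (g a) (z a) (l a)).
Proof.
move=> bmu accmu pl pz pg.
apply: ptime_ext (_ : ptime (fun a => foldl (fun y x => g a x y) (z a) (rev (l a))))
   _; last by move=> a; rewrite foldl_rev.
apply: ptime_foldl bmu _ (ptime_rev pl) pz pg => a i.
rewrite take_rev foldl_rev; apply: (accmu a (take (size (l a) - i) (l a))).
by rewrite cat_take_drop.
Qed.

Lemma ptime_filter (A B : encType) (l : A -> seq B) (p : A -> B -> bool) :
    ptime (fun q : A * B => p q.1 q.2) -> ptime l ->
  ptime (fun a => [seq x <- l a | p a x]).
Proof.
move=> pp pl; have bl := ptime_sz pl.
apply: ptime_ext (_ : ptime (fun a =>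
  foldr (fun x y => if p a x then x :: y else y) [::] (l a))) _; last first.
  by move=> a; elim: (l a) => //= x s ->.
apply: (ptime_foldr (mu := fun a => sz (l a))
  (g := fun a x y => if p a x then x :: y else y)) pl (ptime_nil _ _) _.
- exact: bl.
- move=> a s t ->; apply: (@leq_trans (sz t)).
    elim: t => //= x t; case: ifP; rewrite !sz_cons; lia.
  elim: s => // x s; rewrite cat_cons sz_cons; lia.
- have p21 : ptime (fun x : A * (B * seq B) => x.2.1).
    exact/ptime_fst/ptime_snd/ptime_id.
  have p22 : ptime (fun x : A * (B * seq B) => x.2.2).
    exact/ptime_snd/ptime_snd/ptime_id.
  apply: ptime_if (ptime_cons p21 p22) p22.
  exact: ptime_comp pp (ptime_pair (ptime_fst (ptime_id _)) p21).
Qed.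

Lemma ptime_map (A B C : encType) (l : A -> seq B) (f : A -> B -> C) :
    ptime (fun q : A * B => f q.1 q.2) -> ptime l ->
  ptime (fun a => [seq f a x | x <- l a]).
Proof.
move=> pf pl; have [c cP] := ptime_sz pf. have bl := ptime_sz pl.
apply: (ptime_foldr (g := fun a x y => f a x :: y)
  (mu := fun a => (sz (l a) * ((sz a + sz (l a)).+3 ^ c).+1).+1))
  pl (ptime_nil _ _) _.
- by do ?[exact: pbd_id | exact: bl | apply: pbd_add | apply: pbd_mul
         | apply: pbd_S | apply: pbd_exp].
- move=> a s t ls.
  apply: leq_trans (sz_seq_le (s := map (f a) t) (m := (sz a + sz (l a)).+3 ^ c) _) _.
    move=> _ /mapP[x xt ->]; apply: leq_trans (cP (a, x)) (leq_expl _ _).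
    by rewrite sz_pair /= !ltnS leq_add2l ltnW // sz_mem // ls mem_cat xt orbT.
  rewrite size_map ltnS leq_mul2r; apply/orP; right.
  by have := size_sz (l a); rewrite ls size_cat; lia.
- have p21 : ptime (fun x : A * (B * seq C) => x.2.1).
    exact/ptime_fst/ptime_snd/ptime_id.
  apply: ptime_cons; last exact/ptime_snd/ptime_snd/ptime_id.
  exact: ptime_comp pf (ptime_pair (ptime_fst (ptime_id _)) p21).
Qed.

Lemma ptime_not (A : encType) (b : A -> bool) :
  ptime b -> ptime (fun a => ~~ b a).
Proof.
move=> pb; apply: ptime_ext (ptime_if pb (ptime_bool A false) (ptime_bool A true)) _.
by move=> a; case: (b a).
Qed.

Lemma ptime_and (A : encType) (b c : A -> bool) :
  ptime b -> ptime c -> ptime (fun a => b a && c a).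
Proof. by move=> pb pc; apply: ptime_if pb pc (ptime_bool _ _). Qed.

Lemma ptime_or (A : encType) (b c : A -> bool) :
  ptime b -> ptime c -> ptime (fun a => b a || c a).
Proof. by move=> pb pc; apply: ptime_if pb (ptime_bool _ _) pc. Qed.

Lemma ptime_has (A B : encType) (l : A -> seq B) (p : A -> B -> bool) :
    ptime (fun q : A * B => p q.1 q.2) -> ptime l ->
  ptime (fun a => has (p a) (l a)).
Proof.
move=> pp pl; apply: ptime_ext
  (ptime_not (ptime_eq (ptime_filter pp pl) (ptime_nil _ _))) _.
by move=> a; rewrite has_filter.
Qed.

Lemma ptime_all (A B : encType) (l : A -> seq B) (p : A -> B -> bool) :
    ptime (fun q : A * B => p q.1 q.2) -> ptime l ->
  ptime (fun a => all (p a) (l a)).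
Proof.
move=> pp pl; apply: ptime_ext (ptime_not (ptime_has (ptime_not pp) pl)) _.
by move=> a; rewrite -all_predC; apply: eq_all => x; apply: negbK.
Qed.

Lemma ptime_mem (A B : encType) (x : A -> B) (l : A -> seq B) :
  ptime x -> ptime l -> ptime (fun a => x a \in l a).
Proof.
move=> px pl.
apply: ptime_ext (ptime_has (p := fun a y => y == x a) _ pl) _.
  apply: ptime_eq; first exact/ptime_snd/ptime_id.
  exact: ptime_comp px (ptime_fst (ptime_id _)).
by move=> a; rewrite -has_pred1.
Qed.

Lemma ptime_cat (A B : encType) (f g : A -> seq B) :
  ptime f -> ptime g -> ptime (fun a => f a ++ g a).
Proof.
move=> pf pg; apply: (ptime_comp (g := fun p => p.1 ++ p.2) _ (ptime_pair pf pg)).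
have catE (s t : seq B) : foldr cons t s = s ++ t by elim: s => //= x s ->.
apply: ptime_ext (_ : ptime (fun p => foldr cons p.2 p.1)) (fun p => catE _ _).
apply: (ptime_foldr (mu := @sz _) (g := fun=> cons)).
- exact: pbd_id.
- move=> [p q] s t /= ->; rewrite sz_pair /= catE; apply: leq_trans (sz_cat t q) _.
  elim: s => [|x s]; rewrite ?cat0s ?cat_cons ?sz_cons /=; lia.
- exact/ptime_fst/ptime_id.
- exact/ptime_snd/ptime_id.
- apply: ptime_cons; first exact/ptime_fst/ptime_snd/ptime_id.
  exact/ptime_snd/ptime_snd/ptime_id.
Qed.

Lemma ptime_flatten (A B : encType) (f : A -> seq (seq B)) :
  ptime f -> ptime (fun a => flatten (f a)).
Proof.
move=> pf; apply: (ptime_comp _ pf).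
apply: (ptime_foldr (mu := @sz _) (g := fun _ x y => x ++ y)).
- exact: pbd_id.
- move=> _ s t ->; apply: (@leq_trans (sz t)).
    elim: t => //= x t IHt; apply: leq_trans (sz_cat _ _) _; rewrite sz_cons; lia.
  elim: s => // x s; rewrite cat_cons sz_cons; lia.
- exact: ptime_id.
- exact: ptime_nil.
- apply: ptime_cat; first exact/ptime_fst/ptime_snd/ptime_id.
  exact/ptime_snd/ptime_snd/ptime_id.
Qed.

Lemma ptime_undup (A B : encType) (f : A -> seq B) :
  ptime f -> ptime (fun a => undup (f a)).
Proof.
move=> pf; apply: (ptime_comp _ pf).
pose g (x : B) (y : seq B) := if x \in y then y else x :: y.
have gE (s : seq B) : foldr g [::] s = undup s.
  by elim: s => //= x s ->; rewrite /g mem_undup.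
apply: ptime_ext (_ : ptime (fun s => foldr g [::] s)) gE.
apply: (ptime_foldr (mu := @sz _) (g := fun _ => g)).
- exact: pbd_id.
- move=> _ s t ->; apply: (@leq_trans (sz t)).
    elim: t => //= x t IHt; rewrite sz_cons {1}/g; case: ifP; rewrite ?sz_cons; lia.
  elim: s => // x s; rewrite cat_cons sz_cons; lia.
- exact: ptime_id.
- exact: ptime_nil.
- have p21 : ptime (fun x : seq B * (B * seq B) => x.2.1).
    exact/ptime_fst/ptime_snd/ptime_id.
  have p22 : ptime (fun x : seq B * (B * seq B) => x.2.2).
    exact/ptime_snd/ptime_snd/ptime_id.
  exact: ptime_if (ptime_mem p21 p22) p22 (ptime_cons p21 p22).
Qed.

Ltac ptime_step := try assumption; lazymatch goal with
  | |- ptime fst => refine (@ptime_fst _ _ _ _ (@ptime_id _))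
  | |- ptime snd => refine (@ptime_snd _ _ _ _ (@ptime_id _))
  | |- ptime (fun a => a) => exact: ptime_id
  | |- ptime (fun=> true) => exact: ptime_bool
  | |- ptime (fun=> false) => exact: ptime_bool
  | |- ptime (fun=> [::]) => exact: ptime_nil
  | |- ptime (fun a => (@?f a).1) => refine (@ptime_fst _ _ _ f _)
  | |- ptime (fun a => (@?f a).2) => refine (@ptime_snd _ _ _ f _)
  | |- ptime (fun a => (@?f a, @?g a)) => refine (@ptime_pair _ _ _ f g _ _)
  | |- ptime (fun a => ~~ @?b a) => refine (@ptime_not _ b _)
  | |- ptime (fun a => @?b a || @?c a) => refine (@ptime_or _ b c _ _)
  | |- ptime (fun a => @?b a && @?c a) => refine (@ptime_and _ b c _ _)
  | |- ptime (fun a => @?f a == @?g a) => refine (@ptime_eq _ _ f g _ _)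
  | |- ptime (fun a => @?f a :: @?g a) => refine (@ptime_cons _ _ f g _ _)
  | |- ptime (fun a => behead (@?f a)) => refine (@ptime_behead _ _ f _)
  | |- ptime (fun a => @?f a ++ @?g a) => refine (@ptime_cat _ _ f g _ _)
  | |- ptime (fun a => flatten (@?f a)) => refine (@ptime_flatten _ _ f _)
  | |- ptime (fun a => undup (@?f a)) => refine (@ptime_undup _ _ f _)
  | |- ptime (fun a => filter (@?p a) (@?l a)) =>
      refine (@ptime_filter _ _ l p _ _)
  | |- ptime (fun a => map (@?f a) (@?l a)) => refine (@ptime_map _ _ _ l f _ _)
  | |- ptime (fun a => has (@?p a) (@?l a)) => refine (@ptime_has _ _ l p _ _)
  | |- ptime (fun a => all (@?p a) (@?l a)) => refine (@ptime_all _ _ l p _ _)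
  | |- ptime (fun a => in_mem (@?x a) (mem (@?l a))) =>
      refine (@ptime_mem _ _ x l _ _)
  | |- ptime (fun a => ?h (@?g a)) =>
      refine (@ptime_comp _ _ _ h g _ _); first assumption
  | _ => apply: ptime_if
  end; cbv beta.
Ltac ptime := cbv beta; repeat ptime_step.

(** * The decision procedure *)

Fixpoint bounded_seqs (n : nat) (L : seq lit) : seq (seq lit) :=
  if n is n'.+1 then
    [::] :: flatten [seq [seq x :: E | E <- bounded_seqs n' L] | x <- L]
  else [:: [::]].

(** A sequence [x :: E] in [T] records that the falsification of [E] propagates
    [x]. *)
Definition rup_step (F Cs T : seq (seq lit)) : seq (seq lit) :=
  [seq R <- Cs | has (fun C : seq lit =>
     all (fun y => (y \in R) || (neg y :: behead R \in T)) C) (F ++ T)].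

Definition saturate (F Cs : seq (seq lit)) : seq (seq lit) :=
  foldl (fun T _ => rup_step F Cs T) [::] Cs.

Definition refute (k : nat) (F : seq (seq lit)) : bool :=
  [::] \in saturate F (bounded_seqs k.+1 (flatten F)).

Definition assign (A : seq lit) (F : seq (seq lit)) : seq (seq lit) :=
  [seq [seq x <- C | neg x \notin A] | C <- F & ~~ has (fun x => x \in A) C].

Definition entails (k : nat) (F : seq (seq lit)) (C : seq lit) : bool :=
  refute k F || refute k (assign [seq neg x | x <- C] F).

Definition entails_all (k : nat) (F F' : seq (seq lit)) : bool :=
  all (entails k F) F'.

Definition var_seq (F : seq (seq lit)) : seq nat :=
  undup [seq x.1 | x <- flatten F].

Definition extend_all (k : nat) (F : seq (seq lit)) (v : nat)
    (As : seq (seq lit)) : seq (seq lit) :=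
  [seq A <- [seq (v, true) :: A | A <- As] ++ [seq (v, false) :: A | A <- As]
     | ~~ refute k (assign A F)].

Definition model_seq (k : nat) (F : seq (seq lit)) : seq (seq lit) :=
  foldl (fun As v => extend_all k F v As)
    (if refute k F then [::] else [:: [::]]) (var_seq F).

Lemma ptime_neg (A : encType) (f : A -> lit) :
  ptime f -> ptime (fun a => neg (f a)).
Proof. by move=> pf; rewrite /neg; ptime. Qed.

Lemma ptime_bounded_seqs n (A : encType) (f : A -> seq lit) :
  ptime f -> ptime (fun a => bounded_seqs n (f a)).
Proof.
elim: n A f => [|n IHn] A f pf /=; first by ptime.
by ptime; apply: IHn; ptime.
Qed.

Lemma ptime_rup_step (A : encType) (F Cs T : A -> seq (seq lit)) :
  ptime F -> ptime Cs -> ptime T -> ptime (fun a => rup_step (F a) (Cs a) (T a)).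
Proof.
move=> pF pCs pT; rewrite /rup_step.
by ptime; apply: ptime_neg; ptime.
Qed.

Lemma ptime_saturate (A : encType) (F Cs : A -> seq (seq lit)) :
  ptime F -> ptime Cs -> ptime (fun a => saturate (F a) (Cs a)).
Proof.
move=> pF pCs; rewrite /saturate.
apply: (ptime_foldl (mu := fun a => sz (Cs a))
         (g := fun a _ T => rup_step (F a) (Cs a) T)).
- exact: ptime_sz.
- move=> a i; elim/last_ind: (take i _) => [|s x _]; first exact: sz_gt0.
  by rewrite foldl_rcons sz_filter.
- by ptime.
- by ptime.
- by apply: ptime_rup_step; ptime.
Qed.

Lemma ptime_refute k (A : encType) (F : A -> seq (seq lit)) :
  ptime F -> ptime (fun a => refute k (F a)).
Proof.
move=> pF; rewrite /refute; ptime; apply: ptime_saturate => //.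
by apply: ptime_bounded_seqs; ptime.
Qed.

Lemma ptime_assign (A : encType) (phi : A -> seq lit) (F : A -> seq (seq lit)) :
  ptime phi -> ptime F -> ptime (fun a => assign (phi a) (F a)).
Proof. by move=> pphi pF; rewrite /assign; ptime; apply: ptime_neg; ptime. Qed.

Lemma ptime_entails k (A : encType) (F : A -> seq (seq lit)) (C : A -> seq lit) :
  ptime F -> ptime C -> ptime (fun a => entails k (F a) (C a)).
Proof.
move=> pF pC; rewrite /entails; ptime; apply: ptime_refute => //.
by apply: ptime_assign => //; ptime; apply: ptime_neg; ptime.
Qed.

Lemma ptime_entails_all k (A : encType) (F F' : A -> seq (seq lit)) :
  ptime F -> ptime F' -> ptime (fun a => entails_all k (F a) (F' a)).
Proof.
by move=> pF pF'; rewrite /entails_all; ptime; apply: ptime_entails; ptime.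
Qed.

Lemma ptime_var_seq (A : encType) (F : A -> seq (seq lit)) :
  ptime F -> ptime (fun a => var_seq (F a)).
Proof. by move=> pF; rewrite /var_seq; ptime. Qed.

Lemma ptime_extend_all k (A : encType) (F : A -> seq (seq lit)) (v : A -> nat)
    (As : A -> seq (seq lit)) :
  ptime F -> ptime v -> ptime As ->
  ptime (fun a => extend_all k (F a) (v a) (As a)).
Proof.
move=> pF pv pAs; rewrite /extend_all; ptime.
by apply: ptime_refute; apply: ptime_assign; ptime.
Qed.

Lemma ptime_in_model_seq k (mu : seq (seq lit) -> nat) :
    (forall F, sz F <= mu F) ->
    (forall F i, sz (foldl (fun As v => extend_all k F v As)
       (if refute k F then [::] else [:: [::]]) (take i (var_seq F))) <= mu F) ->
  ptime_in mu (model_seq k).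
Proof.
move=> Fmu accmu; apply: ptime_in_foldl accmu => //.
- by apply: ptime_var_seq; ptime.
- by apply: ptime_if; [apply: ptime_refute| |]; ptime.
- by apply: ptime_extend_all; ptime.
Qed.

(** * Correctness *)

Definition holds (f : tassign) (x : lit) : bool := f x.1 == x.2.
Definition sat_seq (f : tassign) (F : seq (seq lit)) : bool :=
  all (fun C : seq lit => has (holds f) C) F.

Lemma negK (x : lit) : neg (neg x) = x.
Proof. by case: x => v b; rewrite /neg /= negbK. Qed.

Lemma holds_neg f x : holds f (neg x) = ~~ holds f x.
Proof. by rewrite /holds /=; case: (f _) (x.2) => - []. Qed.

Lemma mem_bounded_seqs n L (E : seq lit) :
  (E \in bounded_seqs n L) = (size E <= n) && all (mem L) E.
Proof.
elim: n E => [|n IHn] [|x E] //=.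
rewrite inE /=; apply/flattenP/andP => [[s /mapP[y yL ->] /mapP[E' E'n [-> ->]]]|].
  by move: E'n; rewrite IHn yL ltnS => /andP[-> ->].
case=> En /andP[xL EL]; exists [seq x :: E' | E' <- bounded_seqs n L].
  by apply/mapP; exists x.
by apply/mapP; exists E => //; rewrite IHn EL -ltnS En.
Qed.

Lemma rup_step_sound f F Cs T :
  sat_seq f F -> sat_seq f T -> sat_seq f (rup_step F Cs T).
Proof.
move=> Ff Tf; apply/allP => R; rewrite mem_filter => /andP[/hasP[C CFT CR] _].
have : has (holds f) C.
  by move: CFT; rewrite mem_cat => /orP[] CF; [move/allP: Ff|move/allP: Tf]; apply.
case/hasP=> y yC fy; have /orP[yR|yT] := allP CR y yC.
  by apply/hasP; exists y.
have := allP Tf _ yT; rewrite /= holds_neg fy /=.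
case/hasP=> z zR fz; apply/hasP; exists z => //.
exact: mem_behead zR.
Qed.

Lemma saturate_sound f F Cs : sat_seq f F -> sat_seq f (saturate F Cs).
Proof.
move=> Ff; rewrite /saturate; elim/last_ind: {2}Cs => //= s x IHs.
by rewrite foldl_rcons; apply: rup_step_sound.
Qed.

Lemma refute_sound k F f : refute k F -> ~~ sat_seq f F.
Proof.
move=> kF; apply/negP => /(saturate_sound (bounded_seqs k.+1 (flatten F))).
by move=> /allP/(_ _ kF).
Qed.

Lemma rup_step_mono F Cs (T U : seq (seq lit)) :
  {subset T <= U} -> {subset rup_step F Cs T <= rup_step F Cs U}.
Proof.
move=> TU R; rewrite !mem_filter => /andP[/hasP[C CFT CR] ->]; rewrite andbT.
apply/hasP; exists C.
  by move: CFT; rewrite !mem_cat => /orP[->|/TU ->]; rewrite ?orbT.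
by apply: sub_all CR => y /orP[->|/TU ->]; rewrite ?orbT.
Qed.

Lemma filter_sub_size (T : eqType) (p q : pred T) s :
  {subset filter p s <= filter q s} -> size (filter q s) <= size (filter p s) ->
  filter q s = filter p s.
Proof.
move=> pq; have {}pq x : x \in s -> p x -> q x.
  by move=> xs px; have := pq x; rewrite !mem_filter px xs !andbT; apply.
elim: s pq => //= x s IHs pq.
have {}IHs := IHs (fun y ys => pq y (mem_behead (s := x :: s) ys)).
have sub : size (filter p s) <= size (filter q s).
  rewrite !size_filter; apply: leq_trans (_ : count (predI q (mem s)) s <= _).
    rewrite -(@eq_in_count _ (predI p (mem s))); last by move=> y /= ->; rewrite andbT.
    by apply: sub_count => y /= /andP[py ys]; rewrite ys pq // inE ys orbT.
  by apply: sub_count => y /andP[].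
case px: (p x).
  by rewrite (pq x (mem_head _ _) px) /= ltnS => /IHs ->.
case: ifP => _ /= le; last exact: IHs le.
by have := leq_ltn_trans sub le; rewrite ltnn.
Qed.

Lemma saturateP F Cs : rup_step F Cs (saturate F Cs) = saturate F Cs.
Proof.
pose T i := iter i (rup_step F Cs) [::].
have satE : saturate F Cs = T (size Cs).
  rewrite /saturate; elim/last_ind: {2 3}Cs => //= s x IHs.
  by rewrite foldl_rcons size_rcons IHs.
have Tfilter i : exists p, T i = filter p Cs.
  by case: i => [|i]; [exists pred0; rewrite filter_pred0|eexists].
have Tmono i : {subset T i <= T i.+1}.
  by elim: i => // i IHi; apply: rup_step_mono.
have Tfix i : T i.+1 = T i -> T i.+2 = T i.+1.
  by move=> e; rewrite -[LHS]/(rup_step F Cs (T i.+1)) {1}e.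
have Tle i : size (T i.+1) <= size (T i) -> T i.+1 = T i.
  have [p pE] := Tfilter i; have [q qE] := Tfilter i.+1.
  by move: (Tmono i); rewrite pE qE; apply: filter_sub_size.
have Tgrow i : T i.+1 = T i \/ i < size (T i.+1).
  elim: i => [|i [/Tfix ->|IHi]]; last 1 first.
  - case: (leqP (size (T i.+2)) (size (T i.+1))) => [/Tle|]; first by left.
    by right; apply: leq_ltn_trans IHi _.
  - by case: (leqP (size (T 1)) (size (T 0))) => [/Tle|]; [left|right].
  - by left.
rewrite satE -[LHS]/(T (size Cs).+1).
case: (Tgrow (size Cs)) => // lt; exfalso; move: lt.
have [p ->] := Tfilter (size Cs).+1.
by rewrite ltnNge size_filter count_size.
Qed.

Definition represents (F : seq (seq lit)) (G : clauseset) : Prop :=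
  (forall C, C \in F -> exists2 D, D \in G & C =i D) /\
  (forall D, D \in G -> exists2 C, C \in F & C =i D).

Lemma sat_clauseE f (C : seq lit) (D : clause) :
  C =i D -> reflect (sat_clause f D) (has (holds f) C).
Proof.
move=> CD; apply: (iffP hasP) => -[x xC fx]; exists x; try exact/eqP.
  by rewrite -CD.
by rewrite CD.
Qed.

Lemma satE f F G : represents F G -> reflect (sat f G) (sat_seq f F).
Proof.
move=> [FG GF]; apply: (iffP allP) => [Ff D /GF[C /Ff Cf CD]|Gf C /FG[D /Gf Df CD]].
  exact/(sat_clauseE _ CD).
exact/(sat_clauseE _ CD).
Qed.

(** If the falsification of [E] falsifies all of [C] (by propagation), then it
    leads to a conflict, which propagates every literal; and a derived clause of
    length at most [k] is itself recorded. *)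
Lemma wres_saturate k F G (Cs := bounded_seqs k.+1 (flatten F))
    (S := saturate F Cs) C : represents F G -> wres G k C ->
  {subset C <= flatten F} /\
  (forall E, size E <= k -> {subset E <= flatten F} ->
     (forall y, y \in C -> (y \in E) || (neg y :: E \in S)) ->
   forall R, R \in Cs -> behead R = E -> R \in S).
Proof.
move=> [_ GF].
have closed C' R : C' \in F ++ S -> R \in Cs ->
    (forall y, y \in C' -> (y \in R) || (neg y :: behead R \in S)) -> R \in S.
  move=> C'FS RCs C'R; rewrite /S -saturateP mem_filter RCs andbT.
  by apply/hasP; exists C' => //; apply/allP.
elim=> {C} [C /GF[C' C'F C'C]|C D x _ [CL IHC] _ [DL IHD] res small].
  split=> [x|E Ek EL CE R RCs RE].
    by rewrite -C'C => xC; apply/flattenP; exists C'.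
  apply: (closed C') => // [|y]; first by rewrite mem_cat C'F.
  rewrite C'C => /CE /orP[yE|]; last by rewrite RE => ->; rewrite orbT.
  by rewrite (mem_behead (s := R)) // RE.
have memCs y E : y \in flatten F -> size E <= k -> {subset E <= flatten F} ->
    y :: E \in Cs.
  move=> yL Ek EL; rewrite mem_bounded_seqs /= ltnS Ek yL /=.
  exact/allP.
have [xC xD] : x \in C /\ neg x \in D.
  have : x \in C `&` [fset neg y | y in D] by rewrite res inE.
  by rewrite inE => /andP[xC /imfsetP[y /= yD xy]]; split=> //; rewrite xy negK.
(* a short clause containing [y] lets the falsification of the rest propagate [y] *)
have propagate (C0 : clause) y E : y \in C0 -> #|` C0| <= k ->
    {subset C0 <= flatten F} ->
    (forall E, size E <= k -> {subset E <= flatten F} ->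
       (forall y, y \in C0 -> (y \in E) || (neg y :: E \in S)) ->
     forall R, R \in Cs -> behead R = E -> R \in S) ->
    size E <= k -> {subset E <= flatten F} ->
    (forall z, z \in C0 -> z != y -> (z \in E) || (neg z :: E \in S)) ->
  y :: E \in S.
  move=> yC0 C0k C0L IH Ek EL C0E.
  have yL := C0L _ yC0.
  have yC0S : y :: C0 \in S.
    apply: (IH C0 C0k C0L _ _ (memCs _ _ yL C0k C0L)) => // z zC0.
    by rewrite zC0.
  apply: (closed (y :: C0)); rewrite ?mem_cat ?yC0S ?orbT ?memCs //.
  move=> z; rewrite !inE; case: eqVneq => //= zy zC0.
  exact: C0E.
split=> [y|E Ek EL RE R RCs Rh].
  by rewrite !inE => /orP[] /andP[_]; [apply: CL|apply: DL].
have CE z : z \in C -> z != x -> (z \in E) || (neg z :: E \in S).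
  by move=> zC zx; apply: RE; rewrite !inE zx zC.
have DE z : z \in D -> z != neg x -> (z \in E) || (neg z :: E \in S).
  by move=> zC zx; apply: RE; rewrite !inE zx zC orbT.
case: small => [Ck|Dk].
  apply: (IHD E) => // z zD; have [->|zx] := eqVneq z (neg x); last exact: DE.
  by rewrite negK (propagate C) ?orbT.
apply: (IHC E) => // z zC; have [->|zx] := eqVneq z x; last exact: CE.
by rewrite (propagate D) ?orbT.
Qed.

Lemma refute_complete k F G : represents F G -> wres G k fset0 -> refute k F.
Proof.
move=> FG /(wres_saturate FG)[_ /(_ [::])]; by apply.
Qed.

(** * Resolution completeness and W-hardness *)

Lemma wres_mono F j k C : j <= k -> wres F j C -> wres F k C.
Proof.
move=> jk; elim=> {C} [C CF|C D x _ IHC _ IHD res small]; first exact: wres_axiom.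
by apply: wres_step res _ => //; case: small => small; [left|right];
  apply: leq_trans jk.
Qed.

Lemma fset_var_bound (F : clauseset) :
  exists n, forall C x, C \in F -> x \in C -> x.1 < n.
Proof.
exists (\max_(v <- vars F) v).+1 => C x CF xC; rewrite ltnS.
have xF : x.1 \in vars F by apply/imfset2P; exists C => //; exists x.
exact: (leq_bigmax_seq (F := id) (P := xpredT)) xF isT.
Qed.

Lemma wres_complete F : ~ satisfiable F -> exists k, wres F k fset0.
Proof.
move=> unsat; have [n Fn] := fset_var_bound F.
have main : forall i f, exists k C, [/\ wres F k C,
    forall x, x \in C -> f x.1 != x.2 & forall x, x \in C -> x.1 < n - i].
  elim=> [|i IHi] f.
    have [C CF Cf] : exists2 C, C \in F & ~ sat_clause f C.
      apply: NNPP => nC; apply: unsat; exists f => C CF.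
      by apply: NNPP => nCf; apply: nC; exists C.
    exists 0, C; split; first exact: wres_axiom.
    - by move=> x xC; apply/eqP => fx; apply: Cf; exists x.
    - by move=> x xC; rewrite subn0; apply: Fn xC.
  case: (leqP n i) => [ni|ltin].
    have [k [C [kC Cf Cn]]] := IHi f; exists k, C; split=> // x /Cn; lia.
  pose v := n - i.+1.
  pose g b : tassign := fun w => if w == v then b else f w.
  have [k [C [kC Cf Cn]]] := IHi (g true).
  have [l [D [lD Df Dn]]] := IHi (g false).
  have lt (w : nat) : w != v -> w < n - i -> w < n - i.+1.
    by rewrite /v neq_ltn; lia.
  have keep b (E : clause) : (v, ~~ b) \notin E ->
      (forall x, x \in E -> g b x.1 != x.2) ->
      (forall x, x \in E -> x.1 < n - i) ->
      (forall x, x \in E -> f x.1 != x.2) /\ forall x, x \in E -> x.1 < n - i.+1.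
    move=> vE Ef En.
    have xv x : x \in E -> x.1 != v.
      move=> xE; apply/eqP => x1; move: (Ef x xE) vE; rewrite /g x1 eqxx.
      case: x x1 xE => w c /= -> wE; clear Ef.
      by case: b c wE => - [] // ->.
    by split=> x xE; [have := Ef x xE; rewrite /g (negbTE (xv x xE))
                     |apply: lt; [exact: xv|exact: En]].
  have [vC|vC] := boolP ((v, false) \in C); last first.
    by have [? ?] := keep true C vC Cf Cn; exists k, C.
  have [vD|vD] := boolP ((v, true) \in D); last first.
    by have [? ?] := keep false D vD Df Dn; exists l, D.
  have resid b (E : clause) x : (forall x, x \in E -> g b x.1 != x.2) ->
      x \in E -> x != (v, ~~ b) -> x.1 != v /\ f x.1 != x.2.
    move=> Ef xE; move: (Ef x xE); rewrite /g.
    by case: (eqVneq x.1 v) => //; case: x {xE} => w c /= ->; rewrite xpair_eqE eqxx;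
      case: b c {Ef} => - [].
  exists (maxn (maxn k l) #|` C|), (resolvent D C (v, true)); split.
  - apply: wres_step.
    + by apply: wres_mono lD; lia.
    + by apply: wres_mono kC; lia.
    + apply/fsetP => x; rewrite !inE; apply/andP/eqP => [[xD]|->]; last first.
        by split=> //; apply/imfsetP; exists (v, false).
      case/imfsetP=> y /= yC xy; apply/eqP; apply: contraT => xv.
      have [_ fx] := resid false D x Df xD xv.
      have yv : y != (v, false) by apply: contraNneq xv => yv; rewrite xy yv.
      have [_] := resid true C y Cf yC yv.
      by move: fx; rewrite xy /=; case: (f _) (y.2) => - [].
    + by right; lia.
  - move=> x; rewrite !inE => /orP[] /andP[xv xE].
      by have [] := resid false D x Df xE xv.
    by have [] := resid true C x Cf xE xv.
  - move=> x; rewrite !inE => /orP[] /andP[xv xE]; apply: lt.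
    + by have [] := resid false D x Df xE xv.
    + exact: Dn.
    + by have [] := resid true C x Cf xE xv.
    + exact: Cn.
have [k [C [kC _ C0]]] := main n (fun=> true); exists k.
suff <- : C = fset0 by [].
by apply/fsetP => x; rewrite inE; apply/negP => /C0; rewrite subnn.
Qed.

Lemma whd_unsat_exists F : ~ satisfiable F -> exists h, whd_unsat F h.
Proof.
move=> /wres_complete[k]; elim/ltn_ind: k => k IHk kF.
have [[j [jk jF]]|no] := classic (exists j, j < k /\ wres F j fset0).
  exact: IHk jk jF.
exists k; split=> // j jF; rewrite leqNgt; apply/negP => jk.
by apply: no; exists j.
Qed.

Definition override (phi : passign) (f : tassign) : tassign :=
  fun v => odflt (f v) phi.[? v].

Lemma override_extends phi f : extends (override phi f) phi.
Proof. by move=> v b; rewrite /override => ->. Qed.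

Lemma extends_override phi f : extends f phi -> override phi f =1 f.
Proof.
by move=> fphi v; rewrite /override; case E: (phi.[? v]) => [b|//]; rewrite (fphi v b).
Qed.

Lemma eq_sat f g F : f =1 g -> sat f F -> sat g F.
Proof. by move=> fg Ff C /Ff[x xC fx]; exists x; rewrite -?fg. Qed.

Lemma sat_papply f phi F : sat f (papply phi F) <-> sat (override phi f) F.
Proof.
split=> [Ff C CF|Ff D /imfsetP[C /=]].
  have [/hasP[x xC /eqP phix]|/negP noC] := boolP (has (lit_true phi) C).
    by exists x; rewrite // /override phix.
  have [|x] := Ff [fset x in C | ~~ lit_false phi x].
    by apply/imfsetP; exists C => //=; rewrite !inE CF; apply/negP.
  rewrite !inE /= => /andP[xC nF] fx; exists x; rewrite // /override -fx.
  case E: (phi.[? _]) nF => [b|] //=; rewrite /lit_false E => nb.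
  case: noC; apply/hasP; exists x => //; rewrite /lit_true E.
  by case: b (x.2) nb {E fx} => - [].
rewrite !inE => /andP[CF /hasPn noC] ->; have [x xC fx] := Ff C CF.
have := noC x xC; rewrite /lit_true; move: fx; rewrite /override.
case E: (phi.[? _]) => [b|] /= fx; first by rewrite fx eqxx.
by move=> _; exists x; rewrite // !inE xC /= /lit_false E.
Qed.

Lemma sat_papply_extends f phi F : extends f phi -> sat f F -> sat f (papply phi F).
Proof.
move=> fphi Ff; apply/sat_papply; apply: eq_sat Ff => v.
by rewrite extends_override.
Qed.

Lemma represents_assign A phi F G : (forall x, (x \in A) = lit_true phi x) ->
  represents F G -> represents (assign A F) (papply phi G).
Proof.
move=> Aphi [FG GF].
have hasE (C : seq lit) (D : clause) :
    C =i D -> has (fun x => x \in A) C = has (lit_true phi) D.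
  move=> CD; rewrite (eq_has Aphi); exact: eq_has_r.
have filterE (C : seq lit) (D : clause) : C =i D ->
    [seq x <- C | neg x \notin A] =i [fset x in D | ~~ lit_false phi x].
  by move=> CD x; rewrite mem_filter !inE CD Aphi andbC.
split=> [C' /mapP[C]|D' /imfsetP[D /=]].
  rewrite mem_filter => /andP[nC CF] ->; have [D DG CD] := FG C CF.
  exists [fset x in D | ~~ lit_false phi x]; last exact: filterE.
  by apply/imfsetP; exists D => //=; rewrite !inE DG -(hasE C).
rewrite !inE => /andP[DG nD] ->; have [C CF CD] := GF D DG.
exists [seq x <- C | neg x \notin A]; last exact: filterE.
by apply/mapP; exists C => //; rewrite mem_filter CF (hasE C D) ?nD.
Qed.

Lemma restrictE f V v : (restrict f V).[? v] = if v \in V then Some (f v) else None.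
Proof.
case: ifP => vV; last by rewrite not_fnd ?vV.
by rewrite in_fnd ffunE.
Qed.

Lemma passign_of_lits (A : seq lit) : (forall x, x \in A -> neg x \notin A) ->
  exists phi, forall x, (x \in A) = lit_true phi x.
Proof.
move=> cA; exists (restrict (fun v => (v, true) \in A) [fset x.1 | x in A]) => x.
rewrite /lit_true restrictE; case: ifP => [/imfsetP[y /= yA xy]|].
  case: x y xy yA => v b [w c] /= <- vA.
  have nA := cA _ vA.
  apply/idP/eqP => [bA|[cE]].
    have := cA _ bA; case: b bA => [-> //|_ /negbTE e].
    by rewrite -[(v, true)]/(neg (v, false)) e.
  by case: b c cE nA vA => - [] //= ->.
move/negP => xA; apply/negP => xA'; case: xA.
by apply/imfsetP; exists x.
Qed.

Lemma WC_unsat k F : WC k F -> ~ satisfiable F -> wres F k fset0.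
Proof.
case=> _ [h [] //]; first by move=> _ [Fh _] hk _; apply: wres_mono Fh.
by move=> -> _ _ []; exists (fun=> true) => C; rewrite inE.
Qed.

Lemma WC_papply k F phi : WC k F -> satisfiable F ->
  ~ satisfiable (papply phi F) -> wres (papply phi F) k fset0.
Proof.
case=> _ [h [] //].
  move=> -> _ _ _ []; exists (fun=> true); apply/sat_papply => C.
  by rewrite inE.
move=> _ _ _ Fh hk _ unsat; have [j jF] := whd_unsat_exists unsat.
by apply: wres_mono (proj1 jF); apply: leq_trans hk; apply: Fh jF.
Qed.

Lemma refuteP k F G : WC k G -> represents F G -> refute k F <-> ~ satisfiable G.
Proof.
move=> kG FG; split=> [kF [f /(satE f FG)]|/(WC_unsat kG)].
  by apply/negP; exact: refute_sound kF.
exact: refute_complete.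
Qed.

Lemma refute_assignP k F G A phi :
    WC k G -> satisfiable G -> represents F G ->
    (forall x, (x \in A) = lit_true phi x) ->
  refute k (assign A F) <-> ~ satisfiable (papply phi G).
Proof.
move=> kG Gsat FG Aphi; have AFG := represents_assign Aphi FG.
split=> [kF [f /(satE f AFG)]|/(WC_papply kG Gsat)].
  by apply/negP; exact: refute_sound kF.
exact: refute_complete.
Qed.

Lemma entailsP k F G C D : WC k G -> represents F G -> is_clause D -> C =i D ->
  entails k F C <-> CE (G, D).
Proof.
move=> kG FG cD CD; rewrite /entails /CE /=.
have [kF|kF] := boolP (refute k F) => /=.
  split=> // _ f fG; case: (proj1 (refuteP kG FG) kF); by exists f.
have Gsat : satisfiable G.
  by apply: NNPP => /(refuteP kG FG); apply/negP.
pose A := [seq neg x | x <- C].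
have memA x : (x \in A) = (neg x \in D).
  by rewrite -{1}(negK x) mem_map ?CD //; apply: can_inj negK.
have [phi Aphi] : exists phi, forall x, (x \in A) = lit_true phi x.
  by apply: passign_of_lits => x; rewrite !memA => /cD.
split=> [/(refute_assignP kG Gsat FG Aphi) unsat f fG|GD].
  apply: NNPP => nD; apply: unsat; exists f; apply: sat_papply_extends => // v b vb.
  apply/eqP; apply: contraT => fv; case: nD; exists (v, ~~ b) => /=.
    by rewrite -[(v, ~~ b)]/(neg (v, b)) -memA Aphi /lit_true vb.
  by case: (f v) b fv {vb} => - [].
apply/(refute_assignP kG Gsat FG Aphi) => -[f /sat_papply/GD[x xD]].
have : neg x \in A by rewrite memA negK.
by rewrite Aphi /lit_true /override => /eqP -> /=; case: (x.2).
Qed.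

Lemma entails_allP k F F' G G' : WC k G -> is_clauseset G' ->
  represents F G -> represents F' G' -> entails_all k F F' <-> SE (G, G').
Proof.
move=> kG cG' FG [FG' GF']; rewrite /SE /=; split=> [/allP FF f fG D DG'|GG].
  have [C CF' CD] := GF' D DG'.
  exact: (proj1 (entailsP kG FG (cG' D DG') CD) (FF C CF')) f fG.
apply/allP => C CF'; have [D DG' CD] := FG' C CF'.
apply/(entailsP kG FG (cG' D DG') CD) => f fG; exact: GG fG D DG'.
Qed.

Definition implied (A : seq lit) (F : seq (seq lit)) : bool :=
  all (fun C : seq lit => has (fun x => x \in A) C) F.

Lemma impliedP A phi F G : (forall x, (x \in A) = lit_true phi x) ->
  represents F G -> is_clauseset G -> implied A F <-> IM (G, phi).
Proof.
move=> Aphi [FG GF] cG; rewrite /IM /=; split=> [/allP AF f fphi D DG|GP].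
  have [C CF CD] := GF D DG; have /hasP[x xC xA] := AF C CF.
  exists x; first by rewrite -CD.
  by apply: fphi; apply/eqP; rewrite -[_ == _]/(lit_true phi x) -Aphi.
apply/allP => C CF; have [D DG CD] := FG C CF; apply: contraT => /hasPn nC.
pose f := override phi (fun v => (v, false) \in D).
have [x xD] := GP f (@override_extends _ _) D DG.
have xC : x \in C by rewrite CD.
have := nC x xC; rewrite Aphi /lit_true /f /override.
case: (phi.[? _]) => [b|] /=; first by move=> nb bE; rewrite bE eqxx in nb.
have := cG D DG x xD; case: x xD {xC} => v [] /= xD; last by rewrite xD.
by rewrite /neg /= => /negbTE ->.
Qed.

Lemma nilpP F G : represents F G -> is_clauseset G -> F == [::] <-> VA G.
Proof.
move=> FG cG.
have := @impliedP [::] fmap0 F G _ FG cG.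
case=> [x|H1 H2]; first by rewrite /lit_true fnd_fmap0.
split=> [/eqP F0 f|GP].
  by apply: H1 => [|v b]; [rewrite F0|rewrite fnd_fmap0].
have {H1 H2} := H2 (fun f _ => GP f); case: F {FG} => //= C F.
by rewrite has_pred0.
Qed.

(** * Enumeration of the models *)

Definition asg (f : tassign) (vs : seq nat) : seq lit :=
  rev [seq (v, f v) | v <- vs].

Definition models_upto k F (vs : seq nat) : seq (seq lit) :=
  foldl (fun As v => extend_all k F v As)
    (if refute k F then [::] else [:: [::]]) vs.

Lemma asg_rcons f vs v : asg f (rcons vs v) = (v, f v) :: asg f vs.
Proof. by rewrite /asg map_rcons rev_rcons. Qed.

Lemma mem_asg f vs x : (x \in asg f vs) = (x.1 \in vs) && (f x.1 == x.2).
Proof.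
rewrite mem_rev; apply/mapP/andP => [[v vs_v ->] //|[xvs /eqP fx]].
by exists x.1; rewrite // fx; case: x {xvs fx}.
Qed.

Lemma eq_asg f g vs : (asg f vs == asg g vs) = all (fun v => f v == g v) vs.
Proof.
rewrite /asg (inj_eq (can_inj revK)); elim: vs => //= v vs <-.
by rewrite eqseq_cons xpair_eqE eqxx.
Qed.

Lemma asg_lits f vs : exists phi, forall x, (x \in asg f vs) = lit_true phi x.
Proof.
apply: passign_of_lits => x; rewrite !mem_asg => /andP[-> /eqP fx] /=.
by rewrite fx; case: (x.2).
Qed.

Lemma models_uptoP k F G vs : WC k G -> represents F G -> uniq vs ->
  uniq (models_upto k F vs) /\
  forall A, A \in models_upto k F vs <-> exists2 f, sat f G & A = asg f vs.
Proof.
move=> kG FG; elim/last_ind: vs => [_|vs v IHvs].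
  have [kF|/negbTE kF] := boolP (refute k F); rewrite /models_upto kF /=.
    split=> // A; split=> // -[f fG _].
    by case: (proj1 (refuteP kG FG) kF); exists f.
  have [f fG] : satisfiable G.
    by apply: NNPP => /(refuteP kG FG); rewrite kF.
  split=> // A; rewrite inE; split=> [/eqP ->|[g _ ->]] //; by exists f.
rewrite rcons_uniq => /andP[vvs /IHvs[uAs mAs]].
rewrite /models_upto foldl_rcons -/(models_upto k F vs) /extend_all.
move: (models_upto k F vs) uAs mAs => As uAs mAs; split.
  apply: filter_uniq; rewrite cat_uniq !map_inj_uniq; try by move=> ? ? [].
  rewrite uAs andbT /=; apply/hasPn => _ /mapP[A _ ->].
  by apply/mapP => -[].
have memE A' : (A' \in [seq (v, true) :: A | A <- As] ++
    [seq (v, false) :: A | A <- As]) <-> exists b f, sat f G /\ A' = (v, b) :: asg f vs.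
  rewrite mem_cat; split=> [/orP[] /mapP[A /mAs[f fG ->] ->]|[b [f [fG ->]]]].
  - by exists true, f.
  - by exists false, f.
  have fAs : asg f vs \in As by apply/mAs; exists f.
  by apply/orP; case: b; [left|right]; apply/mapP; exists (asg f vs).
move=> A'; rewrite mem_filter; split=> [/andP[kA /memE[b [f [fG A'E]]]]|[f fG ->]].
  pose f' : tassign := fun w => if w == v then b else f w.
  have {}A'E : A' = asg f' (rcons vs v).
    rewrite asg_rcons /f' eqxx A'E; congr (_ :: _); apply/eqP; rewrite eq_asg.
    by apply/allP => w wvs; case: (eqVneq w v) => // wv; rewrite wv (negbTE vvs) in wvs.
  have [phi Aphi] := asg_lits f' (rcons vs v); rewrite -A'E in Aphi.
  have [g /sat_papply gG] : satisfiable (papply phi G).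
    apply: NNPP => /(refute_assignP kG _ FG Aphi) kA'.
    by move/negP: kA; apply; apply: kA'; exists f.
  exists (override phi g) => //; apply/eqP; rewrite A'E eq_asg; apply/allP => w wvs.
  rewrite eq_sym; apply/eqP/override_extends; apply/eqP.
  by rewrite -[_ == _]/(lit_true phi (w, f' w)) -Aphi A'E mem_asg wvs /=.
apply/andP; split.
  have [phi Aphi] := asg_lits f (rcons vs v).
  apply/negP => /(refute_assignP kG _ FG Aphi); case; first by exists f.
  exists f; apply: sat_papply_extends => // w b wb; apply/eqP.
  have : (w, b) \in asg f (rcons vs v) by rewrite Aphi /lit_true wb.
  by rewrite mem_asg => /andP[].
by apply/memE; rewrite asg_rcons; exists (f v), f.
Qed.

Lemma size_models_take k F G vs i : WC k G -> represents F G -> uniq vs ->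
  size (models_upto k F (take i vs)) <= size (models_upto k F vs).
Proof.
move=> kG FG uvs; have [uAs mAs] := models_uptoP kG FG (take_uniq i uvs).
have [_ mBs] := models_uptoP kG FG uvs.
rewrite -(size_map (drop (size (drop i vs))) (models_upto k F vs)).
apply: uniq_leq_size => // A /mAs[f fG ->]; apply/mapP; exists (asg f vs).
  by apply/mBs; exists f.
have -> : asg f vs = asg f (drop i vs) ++ asg f (take i vs).
  by rewrite /asg -rev_cat -map_cat cat_take_drop.
by rewrite drop_size_cat // size_rev size_map.
Qed.

(** * Encodings *)

Lemma lit_codeE (x : lit) d : lit_code x d <-> d = enc x.
Proof. by []. Qed.

Lemma lits_codeE (s : seq lit) d : list_code lit_code s d <-> d = enc s.
Proof.
split=> [|->]; first by elim=> // x {}s e t /lit_codeE -> _ ->.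
elim: s => [|x s IHs]; first exact: list_code_nil.
exact: list_code_cons.
Qed.

Lemma sz_lits (s : seq lit) : sz s <= (size s * 6).+1.
Proof.
by apply: sz_seq_le => x _; rewrite sz_pair; have := sz_bool x.2; rewrite /sz /=; lia.
Qed.

Lemma card_uniq (T : choiceType) (s : seq T) (X : {fset T}) :
  uniq s -> s =i X -> size s = #|` X|.
Proof. by move=> us sX; apply/perm_size/uniq_perm. Qed.

Lemma clause_codeP C d : clause_code C d ->
  exists s : seq lit, [/\ s =i C, d = enc s & sz s <= (#|` C| * 6).+1].
Proof.
case=> s [us sC /lits_codeE ->]; exists s; split=> //.
by rewrite -(card_uniq us sC) sz_lits.
Qed.

Lemma clauseset_codeP G d : clauseset_code G d ->
  exists F, [/\ represents F G, d = enc F & sz F <= 8 * ell G + 3].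
Proof.
case=> s [us sG code].
have [F [FG -> Fsz]] : exists F : seq (seq lit), [/\
    (forall C, C \in F -> exists2 D, D \in s & C =i D) /\
    (forall D, D \in s -> exists2 C, C \in F & C =i D), d = enc F
    & sz F <= 6 * (\sum_(C <- s) #|` C|) + 2 * size s + 1].
  elim: code => {us sG}
    [|D {}s e d' /clause_codeP[C [CD -> Csz]] _ [F [[FG GF] -> Fsz]]].
    by exists [::]; rewrite big_nil.
  exists (C :: F); split=> //; last first.
    by rewrite sz_cons big_cons -[size (D :: s)]/(size s).+1; move: Csz Fsz; lia.
  split=> E; rewrite inE => /orP[/eqP ->|].
  - by exists D; rewrite ?mem_head.
  - by case/FG=> E' sE' EE'; exists E'; rewrite // inE sE' orbT.
  - by exists C; rewrite ?mem_head.
  - by case/GF=> E' sE' EE'; exists E'; rewrite // inE sE' orbT.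
exists F; split=> //.
  case: FG => FG GF; split=> C; first by move=> /FG[D]; rewrite sG; exists D.
  by rewrite -sG; apply: GF.
have <- : \sum_(C <- s) #|` C| = ell G by apply/perm_big/uniq_perm.
have : size s <= (\sum_(C <- s) #|` C|).+1.
  rewrite -(count_predC (pred1 fset0)) count_uniq_mem // -addn1 addnC.
  apply: leq_add; last by case: (_ \in _).
  rewrite -sum1_count [X in _ <= X](bigID (predC (pred1 fset0))) /=.
  by apply: leq_trans (leq_addr _ _); apply: leq_sum => C; rewrite cardfs_gt0.
lia.
Qed.

Lemma passign_codeP phi d : passign_code phi d ->
  exists A : seq lit, [/\ forall x, (x \in A) = lit_true phi x, d = enc A
    & sz A <= (#|` domf phi| * 6).+1].
Proof.
case=> X Xphi [A [uA AX /lits_codeE ->]]; exists A; split=> //.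
  by move=> x; rewrite AX Xphi.
have Aphi x : (x \in A) = lit_true phi x by rewrite AX Xphi.
apply: leq_trans (sz_lits _) _; rewrite ltnS leq_mul2r /=.
rewrite -(size_map fst); apply: uniq_leq_size.
  rewrite map_inj_in_uniq // => -[v b] [w c]; rewrite !Aphi /lit_true /=.
  by move=> /eqP vb /eqP wc vw; move: vb; rewrite vw wc => -[->].
move=> v /mapP[x]; rewrite Aphi => /eqP phix ->.
by rewrite -fndSome phix.
Qed.

Lemma decidable_of_ptime (I : Type) (A : encType) (code : I -> data -> Prop)
    (size : I -> nat) (dom Q : I -> Prop) (f : A -> bool) c :
    ptime f ->
    (forall i d, dom i -> code i d ->
       exists a, [/\ d = enc a, sz a <= c * size i + c & f a <-> Q i]) ->
  polytime_decidable code size dom Q.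
Proof.
case=> P [T [PT [e Te]]] codeP; exists (P 0), ((c%:P * 'X + c.+2%:P) ^+ e)%R.
move=> i d /codeP/[apply] -[a [-> asz fQ]].
have [t [s [exec_s s0 _ tT]]] := PT 0 (upd (fun=> Defs.Nil) 0 (enc a)) a (updE _ _ _).
exists (f a), t; split=> //; first by exists s.
rewrite horner_exp; apply: leq_trans tT (leq_trans (Te a) _).
have -> : ((c%:P * 'X + c.+2%:P).[size i])%R = c * size i + c.+2.
  by rewrite !hornerE.
by apply: leq_expl; lia.
Qed.

Lemma size_var_seq F : size (var_seq F) <= sz F.
Proof.
apply: leq_trans (size_undup _) _; rewrite size_map.
elim: F => // C F IHF; rewrite [flatten _]/= size_cat sz_cons.
by apply: leq_trans (leq_add (ltnW (size_sz C)) IHF) _; rewrite leqnSn.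
Qed.

Lemma var_seqE F G : represents F G -> var_seq F =i vars G.
Proof.
move=> [FG GF] v; rewrite mem_undup; apply/mapP/imfset2P => /=.
  case=> x /flattenP[C CF xC] ->; have [D DG CD] := FG C CF.
  by exists D => //; exists x; rewrite // -CD.
case=> D DG [x xD ->]; have [C CF CD] := GF D DG.
by exists x => //; apply/flattenP; exists C; rewrite // CD.
Qed.

Lemma sz_models_upto k F G vs : WC k G -> represents F G -> uniq vs ->
  sz (models_upto k F vs) <= (size (models_upto k F vs) * (size vs * 6).+2).+1.
Proof.
move=> kG FG uvs; apply: sz_seq_le => A.
have [_ mAs] := models_uptoP kG FG uvs.
move=> /mAs[f _ ->]; apply: leq_trans (sz_lits _) _.
by rewrite size_rev size_map.
Qed.

Lemma models_enumerable k :
  exists (P : cmd) (p : {poly {poly nat}}),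
    forall F d, WC k F -> clauseset_code F d ->
      exists (M : {fset passign}) out t,
        [/\ is_models F M, fset_code passign_code M out,
            computes P d out t &
            t <= p.[(#|` M|)%:P].[ell F]%R].
Proof.
pose acc F i := models_upto k F (take i (var_seq F)).
pose mu F := sz F + \max_(i < (size (var_seq F)).+1) sz (acc F i).
have [|F i|P [T [PT [e Te]]]] := @ptime_in_model_seq k mu.
- by move=> F; rewrite leq_addr.
- apply: leq_trans (leq_addl _ _).
  have ile : minn i (size (var_seq F)) < (size (var_seq F)).+1 by rewrite ltnS geq_minr.
  have -> : take i (var_seq F) = take (Ordinal ile) (var_seq F).
    rewrite /= /minn; case: ltnP => // le.
    by rewrite take_oversize // take_size.
  exact: (leq_bigmax (F := fun i : 'I__ => sz (acc F i)) (Ordinal ile)).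
exists (P 0), (((48)%:P%:P * ('X + 'X%:P + 1) ^+ 2) ^+ e)%R.
move=> G d kG /clauseset_codeP[F [FG -> Fsz]].
have uvs : uniq (var_seq F) by apply: undup_uniq.
have [uAs mAs] := models_uptoP kG FG uvs.
have VG := var_seqE FG.
pose dec (A : seq lit) := restrict (fun v => (v, true) \in A) (vars G).
have decE f : dec (asg f (var_seq F)) = restrict f (vars G).
  apply/fmapP => v; rewrite !restrictE; case: ifP => // vG.
  by rewrite mem_asg /= VG vG eqb_id.
have dec_inj : {in model_seq k F &, injective dec}.
  move=> A B /mAs[f _ ->] /mAs[g _ ->]; rewrite !decE => fg.
  apply/eqP; rewrite eq_asg; apply/allP => v; rewrite VG => vG.
  have : (restrict f (vars G)).[? v] = (restrict g (vars G)).[? v] by rewrite fg.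
  by rewrite !restrictE vG => -[->].
pose M : {fset passign} := [fset A in [seq dec A | A <- model_seq k F]].
have MA : [seq dec A | A <- model_seq k F] =i M by move=> A; rewrite inE.
have udec : uniq [seq dec A | A <- model_seq k F] by rewrite map_inj_in_uniq.
have szM : size (model_seq k F) = #|` M|.
  by rewrite -(card_uniq udec MA) size_map.
have [t [s [exec_s s0 _ tT]]] := PT 0 (upd (fun=> Defs.Nil) 0 (enc F)) F (updE _ _ _).
exists M, (enc (model_seq k F)), t; split; last 1 first.
- apply: leq_trans tT (leq_trans (Te F) _).
  rewrite !horner_exp.
  have -> : (48%:P%:P * ('X + 'X%:P + 1) ^+ 2).[(#|` M|)%:P].[ell G]%R
     = 48 * ((#|` M| + ell G + 1) * (#|` M| + ell G + 1)).
    by rewrite !hornerE.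
  apply: leq_expl.
  have : mu F <= sz F + (#|` M| * (sz F * 6).+2).+1.
    rewrite leq_add2l; apply/bigmax_leqP => i _.
    apply: leq_trans (sz_models_upto kG FG (take_uniq _ uvs)) _.
    rewrite ltnS leq_mul //.
      by rewrite -szM (size_models_take _ kG FG).
    rewrite !ltnS leq_mul2r /=; apply: leq_trans (size_var_seq F).
    by rewrite size_take_min geq_minr.
  move: Fsz (#|` _|); nia.
- move=> phi; rewrite -MA; split=> [/mapP[A /mAs[f fG ->] ->]|[f fG ->]].
    by exists f; rewrite ?decE.
  by rewrite -decE; apply: map_f; apply/mAs; exists f.
- exists [seq dec A | A <- model_seq k F]; split=> //.
  have : {subset model_seq k F <= model_seq k F} by [].
  elim: {1 3 4}(model_seq k F) => [|A As IHAs] sub; first exact: list_code_nil.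
  apply: list_code_cons; last by apply: IHAs => B BA; apply: sub; rewrite inE BA orbT.
  have [f _ ->] := proj1 (mAs A) (sub A (mem_head _ _)).
  exists [fset x in asg f (var_seq F)].
    by move=> x; rewrite decE inE mem_asg VG /lit_true restrictE; case: ifP.
  exists (asg f (var_seq F)); split; last exact/lits_codeE.
    by rewrite rev_uniq map_inj_uniq // => v w [].
  by move=> x; rewrite inE.
- by exists s.
Qed.

Theorem theorem7p1 (k : nat) :
  (polytime_decidable clauseset_code ell (WC k) CO) /\
  (polytime_decidable (pair_code clauseset_code clause_code)
     (fun FC => ell FC.1 + #|` FC.2|)
     (fun FC => WC k FC.1 /\ is_clause FC.2) CE) /\
  (polytime_decidable clauseset_code ell (WC k) VA) /\
  (polytime_decidable (pair_code clauseset_code passign_code)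
     (fun Fphi => ell Fphi.1 + #|` domf Fphi.2|)
     (fun Fphi => WC k Fphi.1) IM) /\
  (polytime_decidable (pair_code clauseset_code clauseset_code)
     (fun FF => ell FF.1 + ell FF.2)
     (fun FF => WC k FF.1 /\ WC k FF.2) EQ) /\
  (polytime_decidable (pair_code clauseset_code clauseset_code)
     (fun FF => ell FF.1 + ell FF.2)
     (fun FF => WC k FF.1 /\ WC k FF.2) SE) /\
  (exists (P : cmd) (p : {poly {poly nat}}),
    forall F d, WC k F -> clauseset_code F d ->
      exists (M : {fset passign}) out t,
        [/\ is_models F M, fset_code passign_code M out,
            computes P d out t &
            t <= p.[(#|` M|)%:P].[ell F]%R]).
Proof.
split.
  apply: (decidable_of_ptime (f := fun F => ~~ refute k F) (c := 8)).
    by ptime; apply: ptime_refute; ptime.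
  move=> G d kG /clauseset_codeP[F [FG -> Fsz]]; exists F; split=> //; first lia.
  rewrite /CO; split=> [/negP kF|Gsat].
    by apply: NNPP => /(refuteP kG FG).
  by apply/negP => /(refuteP kG FG).
split.
  apply: (decidable_of_ptime (f := fun p => entails k p.1 p.2) (c := 8)).
    by apply: ptime_entails; ptime.
  move=> [G D] d [kG cD] [_ [_ [/clauseset_codeP[F [FG -> Fsz]]
    /clause_codeP[C [CD -> Csz]] ->]]].
  exists (F, C); split=> //; last exact: entailsP.
  by rewrite sz_pair /=; move: Fsz Csz => /=; lia.
split.
  apply: (decidable_of_ptime (f := fun F => F == [::]) (c := 8)); first by ptime.
  move=> G d [cG _] /clauseset_codeP[F [FG -> Fsz]]; exists F; split=> //; first lia.
  exact: nilpP.
split.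
  apply: (decidable_of_ptime (f := fun p => implied p.2 p.1) (c := 8)).
    by rewrite /implied; ptime.
  move=> [G phi] d [cG _] [_ [_ [/clauseset_codeP[F [FG -> Fsz]]
    /passign_codeP[A [Aphi -> Asz]] ->]]].
  exists (F, A); split=> //; last exact: impliedP.
  by rewrite sz_pair /=; move: Fsz Asz => /=; lia.
split.
  apply: (decidable_of_ptime
    (f := fun p => entails_all k p.1 p.2 && entails_all k p.2 p.1) (c := 8)).
    by ptime; apply: ptime_entails_all; ptime.
  move=> [G G'] d [/= kG kG'] [_ [_ [/clauseset_codeP[F [FG -> Fsz]]
    /clauseset_codeP[F' [FG' -> F'sz]] ->]]].
  exists (F, F'); split=> //.
    by rewrite sz_pair /=; move: Fsz F'sz => /=; lia.
  have SE1 := entails_allP kG (proj1 kG') FG FG'.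
  have SE2 := entails_allP kG' (proj1 kG) FG' FG.
  split=> [/andP[/SE1 s1 /SE2 s2] f|GG'].
    by split; [apply: s1|apply: s2].
  by apply/andP; split; [apply/SE1|apply/SE2] => f; apply GG'.
split.
  apply: (decidable_of_ptime (f := fun p => entails_all k p.1 p.2) (c := 8)).
    by apply: ptime_entails_all; ptime.
  move=> [G G'] d [/= kG [cG' _]] [_ [_ [/clauseset_codeP[F [FG -> Fsz]]
    /clauseset_codeP[F' [FG' -> F'sz]] ->]]].
  exists (F, F'); split=> //; last exact: entails_allP.
  by rewrite sz_pair /=; move: Fsz F'sz => /=; lia.
exact: models_enumerable.
Qed.
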